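(* Let $\rho=(r_n)_n$ be an increasing sequence in $[0,1)$ with $r_n\to 1$. There exists $f\in\mathcal{U}_A(\mathbb{D},\rho)$ such that $S_n(f)(\zeta)\to\infty$ as $n\to\infty$ for $m$-almost every $\zeta\in\mathbb{T}$.
   Context: $\mathbb{D}$ is the open unit disc, $\mathbb{T}$ the unit circle, $m$ arclength measure on $\mathbb{T}$. For $f(z)=\sum_k a_kz^k\in H(\mathbb{D})$, $S_n(f)(z)=\sum_{k=0}^na_kz^k$. For $f\in H(\mathbb{D})$, $f_r(z):=f(rz)$; $\mathcal{U}_A(\mathbb{D},\rho)$ is the set of $f\in H(\mathbb{D})$ such that for every compact $K\subset\mathbb{T}$, $K\neq\mathbb{T}$, and every continuous $\varphi$ on $K$ there is an increasing sequence $(n_k)$ with $\sup_{\zeta\in K}|f_{r_{n_k}}(\zeta)-\varphi(\zeta)|\to0$. *)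

(* Defs.v *)
From HB Require Import structures.
From mathcomp Require Import all_boot all_order all_algebra.
From mathcomp Require Import all_classical all_reals all_analysis.
From mathcomp Require Import complex.
Set Implicit Arguments. Unset Strict Implicit. Unset Printing Implicit Defensive.
Import Order.TTheory GRing.Theory Num.Theory.
Import numFieldNormedType.Exports.
Local Open Scope classical_set_scope.
Local Open Scope ring_scope.
Local Open Scope complex_scope.
Notation normc := (@ComplexField.Normc.normc _).

Section Instances.
Variable R : realType.
(* the standard (norm-induced) topology / normed structure on C = R[i] *)
HB.instance Definition _ := NormedModule.copy R[i] (R[i]^o).
End Instances.

Section Defs.
Variable R : realType.
Local Notation C := R[i].

Definition unit_circle : set C := [set z | normc z = 1].

Definition expi (t : R) : C := cos t +i* sin t.

(* f = sum a_k z^k belongs to H(D): the power series converges on D *)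
Definition holo_disc (a : nat -> C) : Prop :=
  forall z : C, normc z < 1 -> cvgn (series (fun k => a k * z ^+ k)).

Definition pseries_val (a : nat -> C) (z : C) : C :=
  limn (series (fun k => a k * z ^+ k)).

Definition partial_sum (a : nat -> C) (n : nat) (z : C) : C :=
  \sum_(0 <= k < n.+1) a k * z ^+ k.

Definition dilate (a : nat -> C) (r : R) (z : C) : C := pseries_val a (r%:C * z).

Definition UA (rho : nat -> R) (a : nat -> C) : Prop :=
  holo_disc a /\
  forall K : set C, K `<=` unit_circle -> K <> unit_circle -> compact K ->
  forall phi : C -> C, {within K, continuous phi} ->
  exists nk : nat -> nat, {homo nk : i j / (i < j)%N} /\
    forall e : R, 0 < e -> \forall k \near \oo,
      forall z, K z -> normc (dilate a (rho (nk k)) z - phi z) < e.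

End Defs.

(* Main.v *)
Require Import Defs.
From HB Require Import structures.
From mathcomp Require Import all_boot all_order all_algebra.
From mathcomp Require Import all_classical all_reals all_analysis.
From mathcomp Require Import complex measurable_realfun.
From mathcomp Require Import zify ring lra.
Set Implicit Arguments. Unset Strict Implicit. Unset Printing Implicit Defensive.
Import Order.TTheory GRing.Theory Num.Theory.
Import numFieldNormedType.Exports.
Local Open Scope classical_set_scope.
Local Open Scope ring_scope.
Local Open Scope complex_scope.
Import ComplexField.Normc.

(** For a stage polynomial [P], a target polynomial [p] and an arc [K], one adds
    [l * c * z^m + T(z/r) * w(z/r)] with [T = p - P] and [r = rho n]: here [w] is
    a polynomial vanishing to order [m] at 0, almost 0 on a large disc and almost
    1 on [K], so that the new dilate by [r] is close to [p] on [K].  Such a [w] of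
    size polynomial in [m] is obtained by iterating [x^2 (3 - 2 x)] on a Runge
    approximation.  The partial sums from degree [m] on are shifted by
    [l * c * z^m]; for a fixed point and a fixed partial sum at most one of the
    integers [l < L] makes the shifted value small, so by averaging some [l] makes
    all these (polynomially many in [m]) partial sums large off a set of small
    measure as soon as [L] is a large multiple of their number.  The shift is
    invisible at radius [r] because [L r^m] tends to 0.  Borel-Cantelli concludes. *)

(** The difficulty is to control every partial sum and not a subsequence. The exceptional set of a
    stage has measure about D/L, where D counts the partial sums concerned, so L must be a large
    multiple of D, while the shift disappears at radius r only if L r^m is small. Hence D has to
    grow more slowly than r^-m, and a bare Runge approximation gives no control of degrees; the
    iteration yields D of order 3^k against m = 2^k. The shift sits at the lowest degree of the new
    block so that it enters all partial sums from there on. Each change is also small at the earlier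
    radii, so that the approximations already achieved survive in the limit. Smallness on discs is
    measured by a weighted l^1 norm of the coefficients: it is submultiplicative, dominates the
    modulus and directly gives convergence of the limit series. Universality needs only countably
    many pairs (arc, polynomial), each treated infinitely often. *)

(** * Elementary estimates for the complex modulus *)

Section ComplexModulus.
Variable R : realType.
Implicit Types (x y z : R[i]) (n : nat).

Lemma normc_ge0 x : 0 <= normc x.
Proof. by case: x => a b; exact: sqrtr_ge0. Qed.

Lemma normcD x y : normc (x + y) <= normc x + normc y.
Proof. exact: le_normcD. Qed.

Lemma normc_opp x : normc (- x) = normc x.
Proof. exact: normcN. Qed.

Lemma normc_distC x y : normc (x - y) = normc (y - x).
Proof. by rewrite -normc_opp opprB. Qed.

Lemma normcB x y : normc (x - y) <= normc x + normc y.
Proof. by rewrite -(normc_opp y) normcD. Qed.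

Lemma normc_triangle y x z : normc (x - z) <= normc (x - y) + normc (y - z).
Proof. by apply: le_trans (normcD _ _); rewrite addrA subrK. Qed.

Lemma normc_lbD x y : normc x - normc y <= normc (x + y).
Proof.
rewrite lerBlDr -{1}(addrK y x); exact: normcB.
Qed.

Lemma normc_lbB x y : normc x - normc y <= normc (x - y).
Proof. by rewrite -(normc_opp y) normc_lbD. Qed.

Lemma normcXn x n : normc (x ^+ n) = normc x ^+ n.
Proof.
by elim: n => [|n IH]; rewrite ?expr0 ?normc1 // !exprS normcM IH.
Qed.

Lemma normc_real (r : R) : normc r%:C = `|r|.
Proof. by rewrite /normc /= expr0n addr0 sqrtr_sqr. Qed.

Lemma normc_nat n : normc (n%:R : R[i]) = n%:R.
Proof.
by rewrite -(rmorph_nat (real_complex R)) normc_real normr_nat.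
Qed.

Lemma normc_sum (I : Type) (r : seq I) (P : pred I) (F : I -> R[i]) :
  normc (\sum_(i <- r | P i) F i) <= \sum_(i <- r | P i) normc (F i).
Proof.
elim/big_ind2: _ => [||//]; first by rewrite normc0.
move=> u a v b ua vb; apply: le_trans (normcD _ _) _; exact: lerD.
Qed.

Lemma normc_eq0 x : (normc x == 0) = (x == 0).
Proof. by apply/eqP/eqP => [/eq0_normc|->] //; exact: normc0. Qed.

Lemma normc_Re x : `|complex.Re x| <= normc x.
Proof.
case: x => a b /=; rewrite -sqrtr_sqr ler_sqrt ?lerDl ?sqr_ge0 //.
by rewrite addr_ge0 ?sqr_ge0.
Qed.

Lemma normc_Im x : `|complex.Im x| <= normc x.
Proof.
case: x => a b /=; rewrite -sqrtr_sqr ler_sqrt ?lerDr ?sqr_ge0 //.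
by rewrite addr_ge0 ?sqr_ge0.
Qed.

Lemma normc_leReIm x : normc x <= `|complex.Re x| + `|complex.Im x|.
Proof.
case: x => a b; have -> : a +i* b = a%:C + b%:C * (0 +i* 1).
  by apply/eqP; rewrite eq_complex /= !(mulr0, mul0r, mulr1, subr0, addr0, add0r) !eqxx.
apply: le_trans (normcD _ _) _; rewrite normcM !normc_real.
by rewrite /= expr0n expr1n add0r sqrtr1 mulr1 !(mulr0, mul0r, mulr1, subr0, addr0, add0r).
Qed.

End ComplexModulus.

(** Neumann series for approximate inverses: if [q] nearly inverts [y], then [y - w] is nearly
    [y (1 - w q)], so [q * t] nearly inverts it once [t] inverts [1 - w q] up to [u]. The right side
    displays the two errors. *)
Lemma shifted_inverseE (A : comNzRingType) (x y w q t u : A) :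
  x = y - w -> (1 - w * q) * t = 1 - u ->
  x * (q * t) - 1 = - u + (y * q - 1) * t.
Proof.
move=> -> h; transitivity ((1 - w * q) * t - 1 + (y * q - 1) * t); first by ring.
by rewrite h; ring.
Qed.

(** * Weighted l^1 norm of polynomials *)

Section PolyNorm.
Variable R : realType.
Local Notation C := R[i].
Implicit Types (p q u v : {poly C}) (s : R) (z a b c : C).

Definition coef_norm s p : R := \sum_(i < size p) normc p`_i * s ^+ i.

Lemma coef_norm_widen s p n : (size p <= n)%N ->
  coef_norm s p = \sum_(i < n) normc p`_i * s ^+ i.
Proof.
move=> pn; rewrite /coef_norm (big_ord_widen n (fun i => normc p`_i * s ^+ i)) //.
rewrite big_mkcond /=; apply: eq_bigr => i _; case: ltnP => // pi.
by rewrite nth_default // normc0 mul0r.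
Qed.

Lemma coef_norm_ge0 s p : 0 <= s -> 0 <= coef_norm s p.
Proof.
by move=> s0; apply: sumr_ge0 => i _; rewrite mulr_ge0 ?normc_ge0 ?exprn_ge0.
Qed.

Lemma coef_norm0 s : coef_norm s 0 = 0.
Proof. by rewrite /coef_norm size_poly0 big_ord0. Qed.

Lemma coef_norm_cons s p c : coef_norm s (p * 'X + c%:P) = coef_norm s p * s + normc c.
Proof.
have h1 : (size (p * 'X + c%:P)%R <= (size p).+1)%N.
  by rewrite size_MXaddC; case: ifP.
rewrite (coef_norm_widen _ h1) big_ord_recl /= coefD coefMX coefC /= add0r expr0 mulr1.
rewrite addrC (coef_norm_widen _ (leqnn _)) mulr_suml; congr (_ + _).
apply: eq_bigr => i _; rewrite coefD coefMX coefC /= addr0 /bump /=.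
by rewrite add1n exprSr mulrA.
Qed.

Lemma coef_normC s c : coef_norm s c%:P = normc c.
Proof. by have := coef_norm_cons s 0 c; rewrite mul0r add0r coef_norm0 mul0r add0r. Qed.

Lemma coef_normMX s p : coef_norm s (p * 'X) = coef_norm s p * s.
Proof. by have := coef_norm_cons s p 0; rewrite normc0 !addr0. Qed.

Lemma coef_normD s p q : 0 <= s -> coef_norm s (p + q) <= coef_norm s p + coef_norm s q.
Proof.
move=> s0; set n := maxn (size p) (size q).
rewrite !(@coef_norm_widen _ _ n) ?leq_maxl ?leq_maxr ?size_polyD //.
rewrite -big_split ler_sum // => i _.
by rewrite /= -mulrDl ler_wpM2r ?exprn_ge0 // coefD normcD.
Qed.

Lemma coef_normZ s c p : coef_norm s (c *: p) = normc c * coef_norm s p.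
Proof.
rewrite (@coef_norm_widen _ (c *: p) (size p)) ?size_scale_leq // mulr_sumr.
by apply: eq_bigr => i _; rewrite coefZ normcM mulrA.
Qed.

Lemma coef_normN s p : coef_norm s (- p) = coef_norm s p.
Proof. by rewrite -scaleN1r coef_normZ normc_opp normc1 mul1r. Qed.

Lemma coef_normM s p q : 0 <= s -> coef_norm s (p * q) <= coef_norm s p * coef_norm s q.
Proof.
move=> s0; elim/poly_ind: p => [|p c IH]; first by rewrite mul0r coef_norm0 mul0r.
rewrite mulrDl; apply: le_trans (coef_normD _ _ s0) _.
rewrite mulrAC coef_normMX mul_polyC coef_normZ coef_norm_cons mulrDl lerD2r mulrAC.
exact: ler_wpM2r.
Qed.

Lemma coef_normMXn s p n : coef_norm s (p * 'X^n) = coef_norm s p * s ^+ n.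
Proof.
elim: n => [|n IH]; first by rewrite expr0 !mulr1.
by rewrite exprSr mulrA coef_normMX IH exprSr mulrA.
Qed.

Lemma ler_coef_norm s t p : 0 <= s -> s <= t -> coef_norm s p <= coef_norm t p.
Proof.
move=> s0 st; apply: ler_sum => i _; rewrite ler_wpM2l ?normc_ge0 //.
by rewrite lerXn2r ?nnegrE // (le_trans s0).
Qed.

Lemma normc_horner s p z : normc z <= s -> normc p.[z] <= coef_norm s p.
Proof.
move=> zs; rewrite horner_coef; apply: le_trans (normc_sum _ _ _) _.
apply: ler_sum => i _; rewrite normcM normcXn ler_wpM2l ?normc_ge0 //.
by rewrite lerXn2r ?nnegrE ?normc_ge0 // (le_trans _ zs) // normc_ge0.
Qed.

(** The correction added at a stage is a dilate by 1/r; its norm at radius [s] is that of the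
    undilated polynomial at radius s/r. *)
Lemma coef_norm_scaleX s c p : coef_norm s (p \Po (c *: 'X)) = coef_norm (normc c * s) p.
Proof.
elim/poly_ind: p => [|p d IH]; first by rewrite comp_poly0 !coef_norm0.
rewrite comp_polyD comp_polyM comp_polyX comp_polyC -scalerAr scalerAl.
by rewrite coef_norm_cons coef_normZ IH coef_norm_cons mulrCA mulrA.
Qed.

(** * Approximate inverses and pole pushing *)

Section Separation.
Variables (s : R) (K : set C).
Hypothesis s0 : 0 <= s.

(** A bound in the maximum of the coefficient norm and the sup norm on [K]. Both are
    submultiplicative, so a geometric series can be run on the disc and on [K] at once. *)
Definition bounded_by p (e : R) :=
  coef_norm s p <= e /\ forall z, K z -> normc p.[z] <= e.

Lemma bounded_byW p e e' : e <= e' -> bounded_by p e -> bounded_by p e'.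
Proof.
by move=> ee [h1 h2]; split => [|z Kz]; [exact: le_trans ee | exact: le_trans (h2 _ Kz) ee].
Qed.

Lemma bounded_byD p q e f :
  bounded_by p e -> bounded_by q f -> bounded_by (p + q) (e + f).
Proof.
move=> [p1 p2] [q1 q2]; split=> [|z Kz].
  by apply: le_trans (coef_normD _ _ s0) _; exact: lerD.
by rewrite hornerD; apply: le_trans (normcD _ _) _; apply: lerD; [exact: p2|exact: q2].
Qed.

Lemma bounded_byM p q e f :
  bounded_by p e -> bounded_by q f -> bounded_by (p * q) (e * f).
Proof.
move=> [p1 p2] [q1 q2]; split=> [|z Kz].
  apply: le_trans (coef_normM _ _ s0) _; apply: ler_pM => //; exact: coef_norm_ge0.
rewrite hornerM normcM; apply: ler_pM; rewrite ?normc_ge0 //; [exact: p2|exact: q2].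
Qed.

Lemma bounded_byN p e : bounded_by p e -> bounded_by (- p) e.
Proof.
by move=> [p1 p2]; split=> [|z Kz]; rewrite ?coef_normN // hornerN normc_opp p2.
Qed.

Lemma bounded_byC c : bounded_by c%:P (normc c).
Proof. by split=> [|z _]; rewrite ?coef_normC // hornerC. Qed.

Lemma bounded_by1 : bounded_by 1 1.
Proof. by have := bounded_byC 1; rewrite normc1. Qed.

Lemma bounded_byXn p e n : bounded_by p e -> bounded_by (p ^+ n) (e ^+ n).
Proof.
move=> h; elim: n => [|n IH]; first by rewrite !expr0; exact: bounded_by1.
by rewrite !exprS; exact: bounded_byM.
Qed.

(** [t] is the sum of the first [n] powers of [u]; the bound 2 reproduces itself because 1 + 2/2 =
    2. *)
Lemma geometric_inverse u n : bounded_by u (2^-1) ->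
  exists2 t, bounded_by t 2 & (1 - u) * t = 1 - u ^+ n.
Proof.
move=> hu; elim: n => [|n [t ht et]].
  exists 0; last by rewrite mulr0 expr0 subrr.
  by split=> [|z _]; rewrite ?coef_norm0 // horner0 normc0.
exists (1 + u * t).
  have := bounded_byD bounded_by1 (bounded_byM hu ht).
  by apply: bounded_byW; lra.
by rewrite mulrDr mulr1 mulrCA et exprS; ring.
Qed.

(** The Runge property that 1/u is a limit of polynomials on the disc and on [K], put
    multiplicatively so that no quotient occurs. *)
Definition almost_invertible u :=
  forall e : R, 0 < e -> exists q, bounded_by (u * q - 1) e.

Lemma almost_invertibleM u v :
  almost_invertible u -> almost_invertible v -> almost_invertible (u * v).
Proof.
move=> iu iv e e0.
have d0 : 0 < Num.min 1 (e / 3) by rewrite lt_min ltr01 divr_gt0.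
have [q hq] := iu _ d0; have [r hr] := iv _ d0; exists (q * r).
have -> : u * v * (q * r) - 1 =
    (u * q - 1) + (v * r - 1) + (u * q - 1) * (v * r - 1) by ring.
apply: bounded_byW (bounded_byD (bounded_byD hq hr) (bounded_byM hq hr)).
move: d0; set d := Num.min _ _ => d0.
have d1 : d <= 1 by rewrite ge_min lexx.
have d3 : d <= e / 3 by rewrite ge_min lexx orbT.
nra.
Qed.

Lemma almost_invertible1 : almost_invertible 1.
Proof.
move=> e e0; exists 1; rewrite mulr1 subrr; split=> [|z _]; first by rewrite coef_norm0 ltW.
by rewrite horner0 normc0 ltW.
Qed.

Lemma half_expn_le (e : R) : 0 < e -> exists n, (2^-1 : R) ^+ n <= e.
Proof.
move=> e0.
have h : `|2^-1 : R| < 1 by rewrite ger0_norm ?invr_ge0 // invf_lt1 ?ltr1n.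
have /cvgrPdist_le/(_ _ e0)[n _ /(_ n)] := @cvg_expr R (2^-1) h.
move=> /(_ (leqnn n)); rewrite sub0r normrN => h2; exists n.
by rewrite (le_trans _ h2) // ler_norm.
Qed.

(** As [b] is at distance [eta] from the disc and from [K], an approximate inverse [q] of ['X - b]
    has size at most 2/eta. Then [(a - b) q] has size at most 1/2, and a geometric series moves the
    pole from [b] to [a]. *)
Lemma almost_invertible_step (eta : R) a b : 0 < eta ->
  s + eta <= normc b -> (forall z, K z -> eta <= normc (z - b)) ->
  normc (a - b) <= eta / 4 ->
  almost_invertible ('X - b%:P) -> almost_invertible ('X - a%:P).
Proof.
move=> eta0 sb Kb ab ib e e0.
have e2 : 0 < e / 2 by rewrite divr_gt0.
have [n hn] := half_expn_le e2.
have d0 : 0 < Num.min 1 (e / 4) by rewrite lt_min ltr01 divr_gt0.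
have [q hq] := ib _ d0.
move: d0 hq; set d := Num.min _ _ => d0 hq.
have d1 : d <= 1 by rewrite ge_min lexx.
have d4 : d <= e / 4 by rewrite ge_min lexx orbT.
have hq2 : bounded_by (('X - b%:P) * q) 2.
  rewrite -[X in bounded_by X](subrK 1).
  by apply: bounded_byW (bounded_byD hq bounded_by1); lra.
have bq : bounded_by q (2 / eta).
  case: hq2 => h1 h2; split.
    rewrite ler_pdivlMr // mulrC.
    have h3 : normc b * coef_norm s q <= coef_norm s q * s + 2.
      have -> : normc b * coef_norm s q = coef_norm s (q * 'X - ('X - b%:P) * q).
        rewrite -coef_normZ; congr coef_norm; rewrite -mul_polyC; ring.
      by apply: le_trans (coef_normD _ _ s0) _; rewrite coef_normN coef_normMX lerD2l.
    have := coef_norm_ge0 q s0; nra.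
  move=> z Kz; have := h2 z Kz; rewrite hornerM normcM !hornerE => h3.
  rewrite ler_pdivlMr // mulrC; apply: le_trans h3.
  by rewrite ler_wpM2r ?normc_ge0 // Kb.
have bY : bounded_by ((a - b)%:P * q) (2^-1).
  apply: bounded_byW (bounded_byM (bounded_byC (a - b)) bq).
  rewrite mulrCA mulrA ler_pdivrMr // mulrC; lra.
have [t ht et] := geometric_inverse n bY.
exists (q * t).
have ab' : 'X - a%:P = 'X - b%:P - (a - b)%:P by rewrite polyCB; ring.
rewrite (shifted_inverseE ab' et).
apply: bounded_byW (bounded_byD (bounded_byN (bounded_byXn n bY)) (bounded_byM hq ht)).
lra.
Qed.

Lemma almost_invertible_path (eta : R) (g : nat -> C) m : 0 < eta ->
  (forall j, (j < m)%N -> [/\ s + eta <= normc (g j),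
     (forall z, K z -> eta <= normc (z - g j)) & normc (g j.+1 - g j) <= eta / 4]) ->
  almost_invertible ('X - (g 0%N)%:P) -> almost_invertible ('X - (g m)%:P).
Proof.
move=> eta0; elim: m => [//|m IH] h i0.
have [h1 h2 h3] := h m (ltnSn m).
apply: almost_invertible_step eta0 h1 h2 h3 _.
by apply: IH => // j jm; apply: h; rewrite ltnS ltnW.
Qed.

(** Starting point of the route of a pole: for |b| = 2 the function z/b has size at most 1/2 on both
    sets, so the geometric series applies. *)
Lemma almost_invertible_far b : s <= 1 -> (forall z, K z -> normc z <= 1) ->
  normc b = 2 -> almost_invertible ('X - b%:P).
Proof.
move=> s1 K1 b2 e e0.
have b0 : b != 0 by rewrite -normc_eq0 b2 pnatr_eq0.
have [n hn] := half_expn_le e0.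
have bY : bounded_by (b^-1 *: 'X) (2^-1).
  split=> [|z Kz].
    rewrite coef_normZ -[X in coef_norm _ X]mul1r coef_normMX coef_normC normc1 normcV b2; lra.
  rewrite !hornerE normcM normcV b2; have := K1 z Kz; lra.
have [t ht et] := geometric_inverse n bY.
exists (- b^-1 *: t).
have -> : ('X - b%:P) * (- b^-1 *: t) = (1 - b^-1 *: 'X) * t.
  rewrite -scalerAr scalerAl; congr (_ * _).
  by rewrite scaleNr scalerBr -mul_polyC -[b^-1 *: b%:P]mul_polyC -polyCM mulVf // opprB.
rewrite et addrAC subrr sub0r; apply: bounded_byN.
by apply: bounded_byW (bounded_byXn n bY).
Qed.

End Separation.
End PolyNorm.

(** * Arcs of the circle and separating polynomials *)

Section UnitCircle.
Variable R : realType.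
Local Notation C := R[i].
Implicit Types (t u : R) (z a : C).

Lemma expiD t u : expi (t + u) = expi t * expi u.
Proof.
apply/eqP; rewrite eq_complex /= cosD sinD; apply/andP; split; apply/eqP => //.
by rewrite addrC.
Qed.

Lemma expi0 : expi (0 : R) = 1.
Proof. by rewrite /expi cos0 sin0. Qed.

Lemma normc_expi t : normc (expi t) = 1.
Proof. by rewrite /= cos2Dsin2 sqrtr1. Qed.

Lemma expi_surj z : normc z = 1 -> exists t, z = expi t.
Proof.
case: z => x y /= h.
have xy : x ^+ 2 + y ^+ 2 = 1.
  by rewrite -[LHS]sqr_sqrtr ?addr_ge0 ?sqr_ge0 // h expr1n.
have x1 : -1 <= x <= 1 by apply/andP; split; nra.
have y2 : 1 - x ^+ 2 = y ^+ 2 by rewrite -xy addrC addKr.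
have [y0|y0] := leP 0 y.
  exists (acos x); rewrite /expi acosK ?in_itv //= sin_acos // y2 sqrtr_sqr.
  by rewrite ger0_norm.
exists (- acos x); rewrite /expi cosN sinN acosK ?in_itv //= sin_acos // y2 sqrtr_sqr.
by rewrite ltr0_norm // opprK.
Qed.

Lemma expi_near0 (e : R) : 0 < e ->
  exists2 d : R, 0 < d & forall u, `|u| < d -> normc (expi u - 1) <= e.
Proof.
move=> e0; have e2 : 0 < e / 2 by rewrite divr_gt0.
have /cvgrPdist_le/(_ _ e2)/nbhs_ballP[d1 /= d10 h1] := @continuous_cos R 0.
have /cvgrPdist_le/(_ _ e2)/nbhs_ballP[d2 /= d20 h2] := @continuous_sin R 0.
exists (Num.min d1 d2); first by rewrite lt_min d10.
move=> u; rewrite lt_min => /andP[u1 u2].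
apply: (le_trans (normc_leReIm (expi u - 1))) => /=; rewrite oppr0 addr0.
have /= := h1 u; rewrite /ball /= sub0r normrN cos0 distrC => /(_ u1).
have /= := h2 u; rewrite /ball /= sub0r normrN sin0 sub0r normrN => /(_ u2).
lra.
Qed.

Definition arc (th : C) (d : R) : set C := [set z | normc z = 1 /\ d <= normc (z - th)].

Lemma exists_nat_ge (x : R) : exists m : nat, x <= m%:R /\ (0 < m)%N.
Proof.
exists (Num.Def.truncn x).+1; split=> //; exact/ltW/truncnS_gt.
Qed.

Section ArcSeparation.
Variables (s d : R) (th : C).
Hypotheses (s0 : 0 <= s) (th1 : normc th = 1) (d0 : 0 < d).

(** Comparing moduli gives |x - 1| <= |z - x th|, and the triangle inequality gives d <= |z - x th|
    + |x - 1|; add the two. *)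
Lemma dist_arc_ray (x : R) z : 0 <= x -> arc th d z -> d / 2 <= normc (z - x%:C * th).
Proof.
move=> x0 [z1 zd].
have nx : normc (x%:C * th) = x by rewrite normcM normc_real th1 mulr1 ger0_norm.
have h1 : normc (x%:C * th - th) = `|x - 1|.
  have -> : x%:C * th - th = (x - 1)%:C * th by rewrite rmorphB /= mulrBl mul1r.
  by rewrite normcM normc_real th1 mulr1.
have h2 := normc_triangle (x%:C * th) z th; rewrite h1 in h2.
have h3 := normc_lbB z (x%:C * th); rewrite z1 nx in h3.
have h4 := normc_lbB (x%:C * th) z; rewrite z1 nx normc_distC in h4.
by have [|] := ler0P (x - 1) => hx; rewrite ?(ler0_norm hx) ?(gtr0_norm hx) in h2; lra.
Qed.

(** The pole starts at 2 th, comes down the ray through the gap at [th] to sg th, then turns along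
    the circle of radius [sg] to [a]. Along this route [eta] bounds from below the distances to the
    disc and to the arc. *)
Lemma almost_invertible_circle (sg : R) a : s < sg < 1 -> normc a = sg ->
  almost_invertible s (arc th d) ('X - a%:P).
Proof.
move=> /andP[ssg sg1] asg.
have sg0 : 0 < sg by exact: le_lt_trans ssg.
pose eta := Num.min (sg - s) (Num.min (1 - sg) (d / 2)).
have eta0 : 0 < eta by rewrite !lt_min !subr_gt0 ssg sg1 divr_gt0.
have eta1 : eta <= sg - s by rewrite ge_min lexx.
have eta2 : eta <= 1 - sg by rewrite !ge_min lexx orbT.
have eta3 : eta <= d / 2 by rewrite !ge_min lexx !orbT.
have ray : almost_invertible s (arc th d) ('X - (sg%:C * th)%:P).
  (* The ray segment is shorter than 2, so with m >= 8/eta equal steps each has length at most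
     eta/4. *)
  have [m [hm m0]] := exists_nat_ge (8 / eta).
  have m0' : 0 < m%:R :> R by rewrite ltr0n.
  pose x (j : nat) : R := 2 - (2 - sg) * (j%:R / m%:R).
  have x0 : x 0%N = 2 by rewrite /x mul0r mulr0 subr0.
  have xm : x m = sg by rewrite /x divff ?gt_eqF // mulr1; ring.
  rewrite -xm; apply: (@almost_invertible_path _ s _ s0 eta (fun j => (x j)%:C * th)) => //.
    move=> j jm.
    have jm1 : 0 <= (j%:R / m%:R : R) <= 1.
      by rewrite divr_ge0 // ler_pdivrMr // mul1r ler_nat ltnW.
    have xj : sg <= x j by rewrite /x; nra.
    split.
    - rewrite normcM normc_real th1 mulr1 ger0_norm; lra.
    - by move=> z Kz; apply: le_trans eta3 _; apply: dist_arc_ray => //; lra.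
    - rewrite -mulrBl -rmorphB normcM normc_real th1 mulr1.
      have -> : x j.+1 - x j = - ((2 - sg) / m%:R).
        by rewrite /x -natr1; field; rewrite gt_eqF.
      rewrite normrN ger0_norm; last by rewrite divr_ge0 //; lra.
      move: hm; rewrite ler_pdivrMr // ler_pdivrMr // => hm; nra.
  rewrite x0; apply: almost_invertible_far => //; first lra.
    by move=> z [-> _].
  by rewrite normcM normc_real th1 mulr1 ger0_norm.
have sth0 : sg%:C * th != 0.
  by rewrite -normc_eq0 normcM normc_real th1 mulr1 normr_eq0 gt_eqF.
have nsth : normc (sg%:C * th) = sg by rewrite normcM normc_real th1 mulr1 gtr0_norm.
have [t et] : exists t, a / (sg%:C * th) = expi t.
  by apply: expi_surj; rewrite normcM normcV nsth asg divff ?gt_eqF.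
have {et} -> : a = sg%:C * th * expi t by rewrite -et mulrCA divff ?mulr1.
have [h h0 hh] := expi_near0 (divr_gt0 eta0 (ltr0n R 4 : 0 < 4%:R)).
(* The + 1 makes the inequality |t|/m < h strict. *)
have [m [hm m0]] := exists_nat_ge ((`|t| + 1) / h).
have m0' : 0 < m%:R :> R by rewrite ltr0n.
pose g (j : nat) : C := sg%:C * th * expi (t * (j%:R / m%:R)).
have g0 : g 0%N = sg%:C * th by rewrite /g mul0r mulr0 expi0 mulr1.
have gm : g m = sg%:C * th * expi t by rewrite /g divff ?gt_eqF // mulr1.
rewrite -gm; apply: (@almost_invertible_path _ s _ s0 eta) => //; last by rewrite g0.
move=> j jm; have ng : normc (g j) = sg by rewrite normcM normc_expi mulr1.
split.
- rewrite ng; lra.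
- by move=> z [z1 _]; have := normc_lbB z (g j); rewrite z1 ng; lra.
- have -> : g j.+1 - g j = g j * (expi (t / m%:R) - 1).
    rewrite mulrBr mulr1 /g -[RHS]/(_ * _ * _ - _) -[in X in _ = X - _]mulrA -expiD.
    congr (_ * expi _ - _); rewrite -natr1; field; by rewrite gt_eqF.
  rewrite normcM ng; apply: le_trans (_ : normc (expi (t / m%:R) - 1) <= _).
    by rewrite ler_piMl ?normc_ge0 // ltW.
  apply: hh; rewrite normrM normfV (gtr0_norm m0') ltr_pdivrMr //.
  by move: hm; rewrite ler_pdivrMr //; nra.
Qed.

End ArcSeparation.

Lemma expn_small (r e : R) : 0 <= r < 1 -> 0 < e ->
  exists n0, forall n, (n0 <= n)%N -> r ^+ n <= e.
Proof.
move=> /andP[r0 r1] e0.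
have h : `|r| < 1 by rewrite ger0_norm.
have /cvgrPdist_le/(_ _ e0)[n0 _ hn] := @cvg_expr R r h.
exists n0 => n /hn; rewrite sub0r normrN => h2.
by rewrite (le_trans _ h2) // ler_norm.
Qed.

(* The rational function z^N / (z^N - sg^N) is close to 0 inside the circle of
   radius sg and close to 1 outside; its poles are pushed to infinity through
   the gap of the arc. *)
Lemma separating_poly (s d e : R) (th : C) : 0 <= s < 1 -> 0 < d ->
  normc th = 1 -> 0 < e ->
  exists w : {poly C}, [/\ w`_0 = 0, coef_norm s w <= e &
    forall z, arc th d z -> normc (w.[z] - 1) <= e].
Proof.
move=> /andP[s0 s1] d0 th1 e0.
pose sg := (s + 1) / 2.
have ssg : s < sg < 1 by rewrite /sg; apply/andP; split; lra.
have sg0 : 0 < sg by rewrite /sg; lra.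
have sg1 : 0 <= sg < 1 by case/andP: ssg => _ ->; rewrite ltW.
have r1 : 0 <= s / sg < 1.
  by rewrite divr_ge0 ?(ltW sg0) //= ltr_pdivrMr // mul1r; case/andP: ssg.
(* It is shown below that |q| (sg^N - s^N) <= 2; then |q| s^N <= e follows from (2 + e) s^N <= e
   sg^N, which dictates this ratio. *)
have e1 : 0 < e / (2 + e) by rewrite divr_gt0 // addr_gt0.
have e2 : 0 < Num.min (2^-1) (e / 4) by rewrite lt_min invr_gt0 ltr0n divr_gt0.
have [n1 h1] := expn_small r1 e1; have [n2 h2] := expn_small sg1 e2.
(* The successor makes N positive, whence the zero constant term of w. *)
pose N := (maxn n1 n2).+1.
have {}h1 : s ^+ N * (2 + e) <= e * sg ^+ N.
  have := h1 N; rewrite /N leqW ?leq_maxl // => /(_ isT).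
  rewrite expr_div_n ler_pdivrMr ?exprn_gt0 // mulrAC ler_pdivlMr //.
  by rewrite addr_gt0.
have {}h2 : sg ^+ N <= Num.min (2^-1) (e / 4) by apply: h2; rewrite leqW ?leq_maxr.
have h3 : sg ^+ N <= 2^-1 by rewrite (le_trans h2) // ge_min lexx.
have h4 : sg ^+ N <= e / 4 by rewrite (le_trans h2) // ge_min lexx orbT.
have x0 : 0 < sg ^+ N by rewrite exprn_gt0.
have y0 : 0 <= s ^+ N by rewrite exprn_ge0.
pose c : C := (sg ^+ N)%:C.
have nc : normc c = sg ^+ N by rewrite normc_real gtr0_norm.
have inv : almost_invertible s (arc th d) ('X^N - c%:P).
  have [rs Drs] := closed_field_poly_normal ('X^N - c%:P : {poly C}).
  rewrite lead_coefDl ?size_polyXn ?size_polyN ?lead_coefXn ?scale1r in Drs; last first.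
    by rewrite (leq_ltn_trans (size_polyC_leq1 _)).
  have rt z : z \in rs -> normc z = sg.
    move=> zr; have /rootP : root ('X^N - c%:P) z by rewrite Drs root_prod_XsubC.
    rewrite !hornerE => /eqP; rewrite subr_eq0 => /eqP zN.
    have /eqP : normc z ^+ N = sg ^+ N by rewrite -normcXn zN nc.
    by rewrite eqrXn2 ?normc_ge0 ?(ltW sg0) // => /eqP.
  rewrite Drs; elim: (rs) rt => [|a l IH] rt.
    rewrite big_nil; exact: almost_invertible1.
  rewrite big_cons; apply: almost_invertibleM => //.
    by apply: (almost_invertible_circle _ th1 d0 ssg) => //; apply: rt; rewrite mem_head.
  by apply: IH => z zl; apply: rt; rewrite in_cons zl orbT.
have e5 : 0 < Num.min 1 (e / 4) by rewrite lt_min ltr01 divr_gt0.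
have [q [q1 q2]] := inv _ e5; move: e5 q1 q2; set e' := Num.min _ _ => e5 q1 q2.
have e'1 : e' <= 1 by rewrite ge_min lexx.
have e'4 : e' <= e / 4 by rewrite ge_min lexx orbT.
exists (q * 'X^N); split.
- by rewrite coefMXn.
- rewrite coef_normMXn.
  have h5 : coef_norm s (('X^N - c%:P) * q) <= 2.
    rewrite -[X in coef_norm s X](subrK 1); apply: le_trans (coef_normD _ _ s0) _.
    rewrite coef_normC normc1; lra.
  have h6 : sg ^+ N * coef_norm s q <= coef_norm s q * s ^+ N + 2.
    have -> : sg ^+ N * coef_norm s q = coef_norm s (q * 'X^N - ('X^N - c%:P) * q).
      rewrite -nc -coef_normZ; congr coef_norm; rewrite -mul_polyC; ring.
    by apply: le_trans (coef_normD _ _ s0) _; rewrite coef_normN coef_normMXn lerD2l.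
  have Q0 := coef_norm_ge0 q s0.
  have xy : 0 < sg ^+ N - s ^+ N by nra.
  rewrite -(ler_pM2r xy); nra.
- move=> z Kz; have z1 : normc z = 1 by case: Kz.
  have := q2 z Kz; rewrite hornerD hornerM hornerN !hornerE => q2z.
  (* On the circle |z^N - c| >= 1 - sg^N >= 1/2, so this identity gives |w - 1| <= 2 (e' + sg^N) <=
     e; hence the thresholds 1/2 and e/4. *)
  have h5 : (z ^+ N - c) * (q.[z] * z ^+ N - 1) = z ^+ N * ((z ^+ N - c) * q.[z] - 1) + c.
    ring.
  have h6 : normc ((z ^+ N - c) * (q.[z] * z ^+ N - 1)) <= e' + sg ^+ N.
    rewrite h5; apply: le_trans (normcD _ _) _.
    by rewrite nc normcM normcXn z1 expr1n mul1r lerD2r.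
  have h7 := normc_lbB (z ^+ N) c; rewrite normcXn z1 expr1n nc in h7.
  rewrite normcM in h6; have := normc_ge0 (q.[z] * z ^+ N - 1); nra.
Qed.

End UnitCircle.

(** * Sharpening the separating polynomial with control of its size *)

Section Amplification.
Variable R : realType.
Local Notation C := R[i].

(** Bernoulli's inequality n b <= (1 + b)^n absorbs the factor n. The base r + (1 - r)/4 stands in
    for [r] so as to be positive even when r = 0, and 1 + b is the ratio of [r'] to it. *)
Lemma mulrn_expn_small (r e : R) : 0 <= r < 1 -> 0 < e ->
  exists n0, forall n, (n0 <= n)%N -> n%:R * r ^+ n <= e.
Proof.
move=> /andP[r0 r1] e0.
pose r' := (r + 1) / 2.
have r'1 : 0 <= r' < 1 by rewrite /r'; apply/andP; split; lra.
have r'0 : 0 < r' by rewrite /r'; lra.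
pose b := r' / (r + (1 - r) / 4) - 1.
have r4 : 0 < r + (1 - r) / 4 by lra.
have b0 : 0 < b by rewrite /b subr_gt0 ltr_pdivlMr // mul1r /r'; lra.
have [n0 h] := expn_small r'1 (mulr_gt0 e0 b0).
exists n0 => n /h {}h.
have h1 : (r + (1 - r) / 4) ^+ n * (n%:R * b) <= r' ^+ n.
  have -> : r' = (r + (1 - r) / 4) * (1 + b).
    by rewrite /b [1 + (_ - 1)]addrC subrK mulrCA divff ?mulr1 // gt_eqF.
  rewrite exprMn ler_wpM2l ?exprn_ge0 ?(ltW r4) //.
  elim: (n) => [|m IH]; first by rewrite mul0r expr0.
  rewrite exprS -natr1.
  have : 1 <= (1 + b) ^+ m by rewrite exprn_ege1 // lerDl ltW.
  nra.
rewrite -(ler_pM2r b0); apply: le_trans h; apply: le_trans h1.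
rewrite mulrAC mulrC ler_wpM2r ?mulr_ge0 ?(ltW b0) //.
by rewrite lerXn2r ?nnegrE ?(ltW r4) // lerDl; lra.
Qed.

(** Since 3^k <= 4^k, the quantity is at most the square of 2^k sqrt(r)^(2^k). This is the balance
    between about 3^k partial sums and a shift in degree 2^k. *)
Lemma exp3_exp2_small (r e : R) : 0 <= r < 1 -> 0 < e ->
  exists k0, forall k, (k0 <= k)%N -> 3 ^+ k * r ^+ (2 ^ k) <= e.
Proof.
move=> /andP[r0 r1] e0.
have q1 : 0 <= Num.sqrt r < 1.
  by rewrite sqrtr_ge0 -sqrtr1 ltr_sqrt.
have e1 : 0 < Num.min 1 e by rewrite lt_min ltr01.
have [n0 h] := mulrn_expn_small q1 e1.
exists n0 => k kn.
have {}h := h (2 ^ k)%N (leq_trans (leq_trans kn (ltnW (ltn_expl k (ltnSn 1)))) (leqnn _)).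
move: h; set y := _ * _ => h.
have y0 : 0 <= y by rewrite mulr_ge0 // exprn_ge0 // sqrtr_ge0.
have y1 : y <= 1 by rewrite (le_trans h) // ge_min lexx.
have y2 : y <= e by rewrite (le_trans h) // ge_min lexx orbT.
apply: le_trans (_ : y ^+ 2 <= _); last by rewrite expr2; nra.
rewrite /y exprMn -exprM mulnC exprM sqr_sqrtr // ler_wpM2r ?exprn_ge0 //.
rewrite natrX -exprM mulnC exprM lerXn2r ?nnegrE ?ler0n //.
by rewrite -natrX ler_nat.
Qed.

(* x |-> x^2 (3 - 2x) fixes 0 and 1 with derivative 0 there, so iterating it
   sharpens a separating polynomial while the order of vanishing doubles and
   the size at most triples. *)
Lemma sharp_separating_poly (s d : R) (th : C) : 0 <= s < 1 -> 0 < d ->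
  normc th = 1 ->
  exists c : nat, forall k : nat, exists q : {poly C},
    let w := q * 'X^(2 ^ k) in
    [/\ (size w <= c * 3 ^ k)%N, coef_norm s w <= 4^-1 ^+ k &
    forall z, arc th d z -> normc (w.[z] - 1) <= 4^-1 ^+ k].
Proof.
move=> s01 d0 th1; have s0 : 0 <= s by case/andP: s01.
have [|w [w1 w2 w3]] := @separating_poly R s d (16^-1) th s01 d0 th1.
  by rewrite invr_gt0.
(* The successor keeps the size bound at least 1, as the constant 3 in the recursion requires. *)
exists (size w).+1 => k.
(* The factor 1/16 strengthens the induction: x <= 1/16 implies x (3 + 2x) <= 1/4, so each iteration
   divides the error by 4. *)
suff [q [h1 h2 h3]] : exists q : {poly C},
    let w' := q * 'X^(2 ^ k) in
    [/\ (size w' <= (size w).+1 * 3 ^ k)%N, coef_norm s w' <= 4^-1 ^+ k * 16^-1 &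
    forall z, arc th d z -> normc (w'.[z] - 1) <= 4^-1 ^+ k * 16^-1].
  have h4 : (4^-1 : R) ^+ k * 16^-1 <= 4^-1 ^+ k.
    by rewrite ler_piMr ?exprn_ge0 ?invr_ge0 // invf_le1 // ler1n.
  by exists q; split=> // [|z Kz]; apply: le_trans h4 => //; exact: h3.
elim: k => [|k [q [h1 h2 h3]]].
  (* As 2^0 = 1, the zero constant term of [w] is exactly the divisibility needed. *)
  exists (drop_poly 1 w) => w'.
  have -> : w' = w.
    rewrite /w' -[in RHS](poly_take_drop 1 w).
    have -> : take_poly 1 w = 0; last by rewrite add0r.
    by apply/polyP => -[|i]; rewrite coef_take_poly coef0.
  by split=> [|| z Kz]; rewrite ?expr0 ?mul1r ?muln1 //; exact: w3.
pose W : {poly C} := q * 'X^(2 ^ k); rewrite /= -/W in h1 h2 h3.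
set y : R := 4^-1 ^+ k in h2 h3.
have y0 : 0 <= y by rewrite exprn_ge0 // invr_ge0.
have y1 : y <= 1 by rewrite exprn_ile1 ?invr_ge0 // invf_le1 // ler1n.
have yS : 4^-1 ^+ k.+1 = 4^-1 * y :> R by rewrite exprS.
exists (q ^+ 2 * (3%:R%:P - 2%:R%:P * W)) => /=.
have -> : q ^+ 2 * (3%:R%:P - 2%:R%:P * W) * 'X^(2 ^ k.+1) =
    W ^+ 2 * (3%:R%:P - 2%:R%:P * W) :> {poly C}.
  by rewrite /W expnS mulnC exprM; ring.
clearbody W; split.
- have hW : (size (3%:R%:P - 2%:R%:P * W)%R <= (size w).+1 * 3 ^ k)%N.
    apply: leq_trans (size_polyD _ _) _; rewrite size_polyN geq_max.
    apply/andP; split.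
      by apply: leq_trans (size_polyC_leq1 _) _; rewrite muln_gt0 expn_gt0.
    by rewrite mul_polyC; apply: leq_trans (size_scale_leq _ _) _.
  apply: leq_trans (size_polyMleq _ _) _.
  apply: leq_trans (leq_pred _) _.
  rewrite expnS mulnCA !mulSn mul0n addn0 addnA; apply: leq_add => //.
  rewrite expr2; apply: leq_trans (size_polyMleq _ _) _.
  by apply: leq_trans (leq_pred _) _; exact: leq_add.
- rewrite yS; set x := coef_norm s W in h2.
  have x0 : 0 <= x by exact: coef_norm_ge0.
  have e1 : coef_norm s (3%:R%:P - 2%:R%:P * W) <= 3 + 2 * x.
    apply: le_trans (coef_normD _ _ s0) _; rewrite coef_normN mul_polyC coef_normZ.
    by rewrite coef_normC !normc_nat.
  have e2 : coef_norm s (W ^+ 2) <= x ^+ 2 by rewrite !expr2; exact: coef_normM.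
  apply: le_trans (coef_normM _ _ s0) _.
  apply: le_trans (ler_pM (coef_norm_ge0 _ s0) (coef_norm_ge0 _ s0) e2 e1) _.
  have x3 : x * (3 + 2 * x) <= 4^-1 by nra.
  rewrite expr2 -mulrA; nra.
- move=> z Kz; have {}h3 := h3 z Kz.
  rewrite yS hornerM horner_exp !hornerE; set v := W.[z] in h3 *.
  have -> : v ^+ 2 * (3%:R - 2%:R * v) - 1 = - ((v - 1) ^+ 2 * (1 + 2%:R * v)) by ring.
  rewrite normc_opp normcM normcXn; set x := normc (v - 1) in h3 *.
  have x0 : 0 <= x by exact: normc_ge0.
  have e1 : normc (1 + 2%:R * v) <= 3 + 2 * x.
    have -> : 1 + 2%:R * v = 3%:R + 2%:R * (v - 1) by ring.
    by apply: le_trans (normcD _ _) _; rewrite normcM !normc_nat.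
  apply: le_trans (ler_wpM2l (exprn_ge0 2 x0) e1) _.
  have x3 : x * (3 + 2 * x) <= 4^-1 by nra.
  rewrite expr2 -mulrA; nra.
Qed.

End Amplification.

(** * Topology of the complex plane and compact subsets of the circle *)

Section ComplexTopology.
Variable R : realType.
Local Notation C := R[i].

(** The norm of [R[i]] takes values in [R[i]]; this converts its radii to real ones and its norm to
    [normc]. *)
Lemma nbhs_normcP (z : C) (P : set C) :
  nbhs z P <-> exists2 d : R, 0 < d & forall y, normc (z - y) < d -> P y.
Proof.
split=> [/nbhs_normP[e /= e0 h]|[d d0 h]].
  have ee : e = (complex.Re e)%:C by rewrite RRe_real // gtr0_real.
  exists (complex.Re e); first by rewrite -ltcR -ee.
  by move=> y hy; apply: h => /=; rewrite ee -[`|_|]/(normc _)%:C ltcR.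
apply/nbhs_normP; exists (d%:C) => /=; first by rewrite ltcR.
by move=> y /=; rewrite -[`|_|]/(normc _)%:C ltcR; exact: h.
Qed.

Lemma cvg_normcP (T : Type) (F : set_system T) (f : T -> C) (l : C) : Filter F ->
  f @ F --> l <-> forall e : R, 0 < e -> \forall x \near F, normc (l - f x) < e.
Proof.
move=> FF; split=> [h e e0|h P /nbhs_normcP[d d0 hd]].
  by apply: (h [set y | normc (l - y) < e]); apply/nbhs_normcP; exists e.
by apply: filterS (h d d0) => x /hd.
Qed.

Lemma compact_unif_continuous (K : set C) (f : C -> C) (e : R) :
  compact K -> {within K, continuous f} -> 0 < e ->
  exists2 d : R, 0 < d & forall x y, K x -> K y -> normc (x - y) < d ->
    normc (f x - f y) <= e.
Proof.
move=> /compact_near_coveringP Kc /subspace_continuousP fc e0.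
pose P (d : R) (x : C) := forall y, K x -> K y -> normc (x - y) < d -> normc (f x - f y) <= e.
have /(Kc R 0^'+ P _)[d /= d0 h] : forall x, K x -> \forall x' \near x & t \near 0^'+, P t x'.
  move=> x Kx.
  have e2 : 0 < e / 2 by rewrite divr_gt0.
  have /cvg_normcP/(_ _ e2)/nbhs_normcP[d d0 hd] := fc x Kx.
  have d2 : 0 < d / 2 by rewrite divr_gt0.
  exists ([set x' | normc (x - x') < d / 2], [set t : R | t < d / 2]).
    split; first by apply/nbhs_normcP; exists (d / 2).
    by apply: nbhs_right_lt.
  move=> [x' t] /= [hx' ht] y Kx' Ky hy.
  have h1 := hd x' _ Kx'; have h2 := hd y _ Ky.
  apply: le_trans (normc_triangle (f x) _ _) _.
  rewrite [normc (f x' - _)]normc_distC.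
  have xy := normc_triangle x' x y.
  have := h1 _; have := h2 _ => {h1 h2} h2 h1.
  have {}h1 : normc (f x - f x') < e / 2 by apply: h1; lra.
  have {}h2 : normc (f x - f y) < e / 2 by apply: h2; lra.
  lra.
exists (d / 2); first by rewrite divr_gt0.
move=> x y Kx Ky xy; apply: (h (d / 2)) => //=.
- by rewrite /ball /= sub0r normrN gtr0_norm ?divr_gt0 // ltr_pdivrMr // ltr_pMr // ltr1n.
- by rewrite divr_gt0.
Qed.

Lemma compact_normc_bounded (K : set C) (f : C -> C) :
  compact K -> {within K, continuous f} ->
  exists2 M : R, 0 <= M & forall z, K z -> normc (f z) <= M.
Proof.
move=> /compact_near_coveringP Kc /subspace_continuousP fc.
pose P (M : R) (x : C) := K x -> normc (f x) <= M.
have /(Kc R +oo P _)[M [Mr h]] : forall x, K x -> \forall x' \near x & t \near +oo, P t x'.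
  move=> x Kx.
  have /cvg_normcP/(_ _ ltr01)/nbhs_normcP[d d0 hd] := fc x Kx.
  exists ([set x' | normc (x - x') < d], [set t : R | normc (f x) + 1 < t]).
    split; first by apply/nbhs_normcP; exists d.
    by apply: nbhs_pinfty_gt; exact: num_real.
  move=> [x' t] /= [hx' ht] Kx'.
  have h1 := hd x' hx' Kx'.
  by have := normc_lbB (f x') (f x); rewrite normc_distC; lra.
exists (Num.max 0 (M + 1)); first by rewrite le_max lexx.
move=> z Kz; apply: (h (Num.max 0 (M + 1))) => //.
by rewrite lt_max ltrDl ltr01 orbT.
Qed.

(** The complement of [K] contains a neighbourhood of some point of the circle. Moving that point to
    a rational angle and rounding the gap down to 1/(j+1) leaves only countably many arcs to
    handle. *)
Lemma proper_compact_arc (K : set C) : compact K -> K `<=` @unit_circle R ->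
  K <> @unit_circle R -> exists (a : rat) (j : nat),
    K `<=` arc (expi (ratr a)) (j.+1%:R^-1).
Proof.
move=> Kc KT KnT.
have [z [zT nKz]] : exists z : C, unit_circle z /\ ~ K z.
  apply: contrapT => h; apply: KnT; apply/seteqP; split=> // z zT.
  by apply: contrapT => nK; apply: h; exists z.
have [t zt] := expi_surj zT.
have cK : closed K by apply: compact_closed => //; exact: (@norm_hausdorff _ R[i]).
have /nbhs_normcP[d d0 hd] : nbhs z (~` K).
  by apply: open_nbhs_nbhs; split=> //; exact: closed_openC.
have d2 : 0 < d / 2 by rewrite divr_gt0.
have [r r0 hr] := expi_near0 d2.
have [a] : exists a : rat, ratr a \in `](t - r), (t + r)[.
  by apply: rat_in_itvoo; lra.
rewrite in_itv /= => /andP[a1 a2].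
have az : normc (expi (ratr a) - z) <= d / 2.
  have -> : expi (ratr a) - z = z * (expi (ratr a - t) - 1).
    by rewrite mulrBr mulr1 zt -expiD [t + _]addrC subrK.
  by rewrite normcM zT mul1r; apply: hr; rewrite ltr_norml; apply/andP; split; lra.
have [j [hj _]] := exists_nat_ge (2 / d).
exists a, j => x Kx; split; first exact: KT.
have j1 : j.+1%:R^-1 <= d / 2.
  rewrite -[d / 2]invrK lef_pV2 ?posrE ?invr_gt0 ?ltr0n // invf_div.
  by rewrite (le_trans hj) // ler_nat.
apply: (le_trans j1).
have xz : d <= normc (z - x) by rewrite leNgt; apply/negP => /hd.
have := normc_triangle (expi (ratr a)) x z; rewrite normc_distC in xz; lra.
Qed.

End ComplexTopology.

(** * Polynomial approximation on proper compact subsets of the circle *)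

Section Density.
Variable R : realType.
Local Notation C := R[i].

Lemma expi_prim (n : nat) : (0 < n)%N ->
  n.-primitive_root (expi (2 * pi / n%:R) : C).
Proof.
move=> n0; have n0' : 0 < n%:R :> R by rewrite ltr0n.
have pi0 := pi_gt0 R.
have eX (t : R) k : expi t ^+ k = expi (t * k%:R).
  elim: k => [|k IH]; first by rewrite expr0 mulr0 expi0.
  by rewrite exprSr IH -expiD -natr1 mulrDr mulr1.
have cos1 (x : R) : 0 < x < 2 * pi -> cos x <> 1.
  suff key (y : R) : 0 < y <= pi -> cos y <> 1.
    move=> /andP[x0 x2] c1; have [xp|xp] := leP x pi.
      by apply: (key x) => //; rewrite x0.
    apply: (key (2 * pi - x)); first by apply/andP; split; lra.
    rewrite -[RHS]c1 -(cosN (2 * pi - x)) opprB mulr_natl.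
    by rewrite -[in RHS](subrK (pi *+ 2) x) cosD2pi.
  move=> /andP[y0 yp] c1; have : y = 0; last by move=> yE; rewrite yE ltxx in y0.
  by apply: (@cos_inj R); rewrite ?in_itv /= ?lexx ?(ltW y0) ?(ltW pi0) // cos0.
apply/andP; split=> //; apply/forallP => i /=.
rewrite unity_rootE eX; apply/eqP.
have [->|ne] := eqVneq i.+1 n.
  apply/eqP; rewrite divfK ?gt_eqF // mulr_natl /expi.
  have := cosD2pi (0 : R); have := sinD2pi (0 : R).
  by rewrite !add0r cos0 sin0 => -> ->.
apply/negP => /eqP/(congr1 (@complex.Re R)) /=; apply: cos1.
have lt : (i.+1 < n)%N by rewrite ltn_neqAle ne ltn_ord.
rewrite mulr_gt0 ?divr_gt0 ?mulr_gt0 ?ltr0n //=.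
by rewrite mulrAC ltr_pdivrMr // ltr_pM2l ?ltr_nat // mulr_gt0.
Qed.

Lemma sum_prim_root (n : nat) (w : C) m : n.-primitive_root w ->
  \sum_(j < n) w ^+ (j * m) = if (n %| m)%N then n%:R else 0.
Proof.
move=> pw; under eq_bigr => j _ do rewrite mulnC exprM.
case: ifP => nm.
  have -> : w ^+ m = 1.
    by rewrite -(expr0 w); apply/eqP; rewrite (eq_prim_root_expr pw) mod0n.
  under eq_bigr => j _ do rewrite expr1n.
  by rewrite sumr_const card_ord.
have w1 : w ^+ m - 1 != 0.
  by rewrite subr_eq0 -[X in _ == X](expr0 w) (eq_prim_root_expr pw) mod0n; exact: negbT.
apply: (mulfI w1); rewrite -subrX1 mulr0 -exprM mulnC exprM.
by rewrite (prim_expr_order pw) expr1n subrr.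
Qed.

Lemma unit_mul_conj (u : C) : normc u = 1 -> u * u^*%C = 1.
Proof. by move=> u1; rewrite -sqr_normc -[`|u|]/(normc u)%:C u1 expr1n. Qed.

(** On the circle |u + z|^2 = (u + z)(1/u + 1/z). Even powers of |u + z| are thus polynomials in [z]
    up to a power of [z], which is the origin of the kernel below. *)
Lemma unit_add_sq (u z : C) : normc u = 1 -> normc z = 1 ->
  (u + z) ^+ 2 = u * z * ((normc (u + z)) ^+ 2)%:C.
Proof.
move=> /unit_mul_conj hu /unit_mul_conj hz.
rewrite rmorphXn /= -[(normc _)%:C]/(`|u + z|) sqr_normc rmorphD /=.
have -> : u * z * ((u + z) * (u^* + z^*)) = (u + z) * ((u * u^*) * z + u * (z * z^*)) by ring.
by rewrite hu hz; ring.
Qed.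

Lemma unit_parallelogram (u z : C) : normc u = 1 -> normc z = 1 ->
  normc (u + z) ^+ 2 + normc (u - z) ^+ 2 = 4.
Proof.
have sq (x : C) : normc x ^+ 2 = complex.Re x ^+ 2 + complex.Im x ^+ 2.
  by case: x => a b /=; rewrite sqr_sqrtr // addr_ge0 ?sqr_ge0.
move=> hu hz; have := sq u; have := sq z; rewrite hu hz !expr1n !sq.
by case: u {hu} => a b; case: z {hz} => c d /= h1 h2; nra.
Qed.

Section Kernel.
Variables (n : nat) (w : C).
Hypothesis pw : (n.*2.+1).-primitive_root w.

Let u (j : nat) : C := w ^+ j.

Lemma normc_prim j : normc (u j) = 1.
Proof.
rewrite normcXn; suff -> : normc w = 1 by rewrite expr1n.
apply/eqP; rewrite -(@eqrXn2 _ n.*2.+1) ?normc_ge0 //.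
by rewrite -normcXn (prim_expr_order pw) normc1 expr1n.
Qed.

(** The weights |u_j + z|^(2n) form a de la Vallee Poussin kernel sampled at roots of unity. Times
    z^n they are polynomials in [z], because u_j^(2n+1) = 1. *)
Lemma kernel_factor j z : normc z = 1 ->
  u j ^+ n.+1 * (u j + z) ^+ n.*2 = z ^+ n * (normc (u j + z) ^+ n.*2)%:C.
Proof.
move=> z1; rewrite -[n.*2]mul2n !exprM (unit_add_sq (normc_prim j) z1) !exprMn !rmorphXn /=.
have h : u j ^+ n.+1 * u j ^+ n = 1.
  by rewrite -exprD addSn addnn /u -exprM mulnC exprM (prim_expr_order pw) expr1n.
by rewrite !mulrA h mul1r -!rmorphXn /= -exprMn.
Qed.

(** Summation over the roots keeps only exponents divisible by 2n + 1. The exponent of u_j in the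
    i-th binomial term is 3n + 1 - i, between n + 1 and 3n + 1, so only i = n survives and the mass
    does not depend on [z]. *)
Lemma kernel_sum z : normc z = 1 ->
  \sum_(j < n.*2.+1) normc (u j + z) ^+ n.*2 = (n.*2.+1 * 'C(n.*2, n))%:R.
Proof.
move=> z1; apply: (@complexI R); rewrite rmorph_sum rmorph_nat /=.
have zn : z ^+ n != 0 by rewrite -normc_eq0 normcXn z1 expr1n oner_eq0.
apply: (mulfI zn); rewrite mulr_sumr.
under eq_bigr => j _ do rewrite -kernel_factor // exprDn mulr_sumr.
rewrite exchange_big /=.
have nn : (n < n.*2.+1)%N by rewrite ltnS -addnn leq_addr.
rewrite (bigD1 (Ordinal nn)) //= [X in _ + X]big1 => [|i ni].
  rewrite addr0 -addnn addnK addnn.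
  under eq_bigr => j _ do rewrite mulrnAr mulrA -exprD -exprM addSn addnn.
  rewrite sumrMnl -mulr_suml sum_prim_root // dvdnn -mulr_natl natrM; ring.
under eq_bigr => j _ do rewrite mulrnAr mulrA -exprD -exprM.
rewrite sumrMnl -mulr_suml sum_prim_root //; case: ifP => h; last by rewrite mul0r mul0rn.
suff: nat_of_ord i = n by move=> e; rewrite -val_eqE /= e eqxx in ni.
have ilt := ltn_ord i.
by move: h => /dvdnP[[|[|k]]]; rewrite ?mulSn; lia.
Qed.

(** The mass may be computed at z = 1, where the node 1 alone contributes 2^(2n). Nodes far from [z]
    will carry only 4^n r^n with r < 1. *)
Lemma kernel_mass_ge : (4 : R) ^+ n <= (n.*2.+1 * 'C(n.*2, n))%:R.
Proof.
rewrite -(@kernel_sum 1) ?normc1 // (bigD1 ord0) //.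
have -> : normc (u (@ord0 n.*2) + 1) = 2 by rewrite /u expr0 -[1 + 1]/(2%:R) normc_nat.
rewrite -mul2n exprM.
have -> : (2 : R) ^+ 2 = 4 by ring.
by rewrite lerDl sumr_ge0 // => j _; rewrite exprn_ge0 ?normc_ge0.
Qed.

End Kernel.

(** Averaging samples of [phi] against the kernel produces z^n phi(z) rather than phi(z), since only
    z^n times the kernel is a polynomial; [poly_dense] removes the factor. *)
Lemma kernel_approx (K : set C) (phi : C -> C) (e : R) : compact K ->
  K `<=` @unit_circle R -> {within K, continuous phi} -> 0 < e ->
  exists (n : nat) (G : {poly C}), forall z, K z -> normc (G.[z] - z ^+ n * phi z) <= e.
Proof.
move=> Kc KT fc e0.
have e2 : 0 < e / 2 by rewrite divr_gt0.
have [M M0 hM] := compact_normc_bounded Kc fc.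
have [d d0 hd] := compact_unif_continuous Kc fc e2.
pose eta := Num.min 1 (d / 3).
have eta0 : 0 < eta by rewrite lt_min ltr01 divr_gt0.
have eta1 : eta <= 1 by rewrite ge_min lexx.
have eta2 : eta <= d / 3 by rewrite ge_min lexx orbT.
(* Nodes may lie outside [K]: the sample at [u] is the value of [phi] at some point of [K] within
   [eta] of [u], or 0 if there is none. No extension of [phi] to the circle is needed; 2 eta < d
   gives the estimate. *)
have [f hf] : {f : C -> C & forall u, normc (f u) <= M /\
    forall z, K z -> normc (u - z) <= eta -> normc (f u - phi z) <= e / 2}.
  apply: (@choice _ _ (fun u y => normc y <= M /\
    forall z, K z -> normc (u - z) <= eta -> normc (y - phi z) <= e / 2)) => u.
  have [[y [Ky yu]]|h] := pselect (exists y, K y /\ normc (u - y) <= eta).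
    exists (phi y); split=> [|z Kz zu]; first exact: hM.
    apply: hd => //; have := normc_triangle u y z.
    by rewrite [normc (y - u)]normc_distC; lra.
  exists 0; split=> [|z Kz zu]; first by rewrite normc0.
  by exfalso; apply: h; exists z.
(* By the parallelogram law, |u - z| >= eta forces |u + z|^2 <= 4 - eta^2 = 4 r. *)
pose r := 1 - eta ^+ 2 / 4.
have r01 : 0 <= r < 1 by rewrite /r; apply/andP; split; nra.
(* There are N = 2n + 1 <= 3n nodes (n is a successor), and each far one costs at most 2M 4^n r^n;
   this explains the 6, and M + 1 avoids dividing by 0. *)
have e3 : 0 < e / 2 / (6 * (M + 1)) by rewrite !divr_gt0 // mulr_gt0 //; lra.
have [n0 hn] := mulrn_expn_small r01 e3.
pose n := n0.+1; pose N := n.*2.+1.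
have pw : N.-primitive_root (expi (2 * pi / N%:R) : C) by exact: expi_prim.
set w := expi _ in pw; pose A : R := (N * 'C(n.*2, n))%:R.
have A4 : 4 ^+ n <= A by exact: (kernel_mass_ge pw).
have A0 : 0 < A by apply: lt_le_trans A4; rewrite exprn_gt0.
exists n; exists ((A^-1)%:C *:
  \sum_(j < N) (f (w ^+ j) * (w ^+ j) ^+ n.+1) *: ((w ^+ j)%:P + 'X) ^+ n.*2).
move=> z Kz; have z1 : normc z = 1 by exact: KT.
pose W (j : nat) : R := normc (w ^+ j + z) ^+ n.*2.
have sW : \sum_(j < N) W j = A by exact: (kernel_sum pw).
have W0 j : 0 <= W j by rewrite exprn_ge0 ?normc_ge0.
have -> : z ^+ n * phi z = (A^-1)%:C * \sum_(j < N) z ^+ n * (phi z * (W j)%:C).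
  rewrite -mulr_sumr -mulr_sumr -rmorph_sum /= sW.
  transitivity (z ^+ n * phi z * ((A^-1)%:C * A%:C)); last by ring.
  by rewrite -rmorphM /= mulVf ?gt_eqF // mulr1.
rewrite hornerZ -mulrBr normcM normc_real gtr0_norm ?invr_gt0 //.
rewrite ler_pdivrMl //.
have -> : (\sum_(j < N) (f (w ^+ j) * (w ^+ j) ^+ n.+1) *: ((w ^+ j)%:P + 'X) ^+ n.*2).[z]
   = \sum_(j < N) z ^+ n * (f (w ^+ j) * (W j)%:C).
  rewrite horner_sum; apply: eq_bigr => j _.
  rewrite hornerZ horner_exp hornerD hornerC hornerX -mulrA.
  by rewrite (kernel_factor pw j z1) mulrCA.
rewrite -sumrB; apply: le_trans (normc_sum _ _ _) _.
have term (j : nat) : normc (z ^+ n * (f (w ^+ j) * (W j)%:C) - z ^+ n * (phi z * (W j)%:C))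
   <= e / 2 * W j + 2 * M * (4 ^+ n * r ^+ n).
  rewrite -mulrBr -mulrBl !normcM normcXn z1 expr1n mul1r normc_real ger0_norm //.
  have [f1 f2] := hf (w ^+ j).
  have u1 : normc (w ^+ j) = 1 by exact: (normc_prim pw).
  have t0 : 0 <= 2 * M * (4 ^+ n * r ^+ n).
    by rewrite !mulr_ge0 ?exprn_ge0 //; case/andP: r01.
  have [near|far] := leP (normc (w ^+ j - z)) eta.
    have := f2 z Kz near; have := W0 j; nra.
  have hW : W j <= 4 ^+ n * r ^+ n.
    rewrite /W -mul2n exprM -exprMn lerXn2r ?nnegrE ?exprn_ge0 ?normc_ge0 //.
      by rewrite mulr_ge0 //; case/andP: r01.
    have := unit_parallelogram u1 z1; rewrite /r.
    have : eta ^+ 2 <= normc (w ^+ j - z) ^+ 2.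
      by rewrite lerXn2r ?nnegrE ?normc_ge0 ?ltW.
    lra.
  have fp : normc (f (w ^+ j) - phi z) <= 2 * M.
    by apply: le_trans (normcB _ _) _; have := hM z Kz; lra.
  have := ler_pM (normc_ge0 _) (W0 j) fp hW; have := W0 j; nra.
apply: (le_trans (ler_sum _ (fun (j : 'I_N) _ => term j))).
rewrite big_split /= -mulr_sumr sW sumr_const card_ord.
have hr : N%:R * r ^+ n <= 3 * (e / 2 / (6 * (M + 1))).
  apply: le_trans (_ : 3 * (n%:R * r ^+ n) <= _); last first.
    by rewrite ler_wpM2l // hn.
  rewrite mulrA ler_wpM2r ?exprn_ge0 //; first by case/andP: r01.
  by rewrite -natrM ler_nat /N mulSn mul2n -add1n leq_add2r.
have h4 : N%:R * (2 * M * (4 ^+ n * r ^+ n)) <= e / 2 * 4 ^+ n.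
  have -> : N%:R * (2 * M * (4 ^+ n * r ^+ n)) = (2 * M * (N%:R * r ^+ n)) * 4 ^+ n by ring.
  rewrite ler_wpM2r ?exprn_ge0 //.
  apply: le_trans (ler_wpM2l _ hr) _; first by rewrite mulr_ge0.
  have -> : 2 * M * (3 * (e / 2 / (6 * (M + 1)))) = e / 2 * (M / (M + 1)).
    by field; rewrite gt_eqF //; lra.
  rewrite ler_piMr ?(ltW e2) // ler_pdivrMr; lra.
rewrite -mulr_natl; nra.
Qed.

(** Because [K] misses part of the circle, some w = q z^(2^k) is nearly 1 on it. For 2^k >= n the
    product of G, w and z^-n is still a polynomial, which undoes the factor z^n. *)
Lemma poly_dense (K : set C) (phi : C -> C) (e : R) : compact K ->
  K `<=` @unit_circle R -> K <> @unit_circle R -> {within K, continuous phi} -> 0 < e ->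
  exists p : {poly C}, forall z, K z -> normc (p.[z] - phi z) <= e.
Proof.
move=> Kc KT KnT fc e0.
have e2 : 0 < e / 2 by rewrite divr_gt0.
have [a [j hK]] := proper_compact_arc Kc KT KnT.
have [n [G hG]] := kernel_approx Kc KT fc e2.
have s01 : 0 <= (0 : R) < 1 by rewrite lexx ltr01.
have j0 : 0 < j.+1%:R^-1 :> R by rewrite invr_gt0 ltr0n.
have [c hc] := sharp_separating_poly s01 j0 (normc_expi (ratr a)).
have r01 : 0 <= (4^-1 : R) < 1 by rewrite invr_ge0 ler0n invf_lt1 ?ltr1n.
have g0 := coef_norm_ge0 G (ler01 : 0 <= (1 : R)).
have e3 : 0 < e / 2 / (coef_norm 1 G + 1) by rewrite !divr_gt0 //; lra.
have [k0 hk] := expn_small r01 e3.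
pose k := maxn k0 n; have [q [_ _ hq]] := hc k.
have nk : (n <= 2 ^ k)%N.
  by rewrite (leq_trans (leq_maxr k0 n)) // ltnW // ltn_expl.
exists (G * q * 'X^(2 ^ k - n)) => z Kz.
have z1 : normc z = 1 by exact: KT.
have z0 : z ^+ n != 0 by rewrite -normc_eq0 normcXn z1 expr1n oner_eq0.
have {}hq := hq z (hK z Kz); have {}hG := hG z Kz.
have {}hk := hk k (leq_maxl _ _).
have nG : normc G.[z] <= coef_norm 1 G by apply: normc_horner; rewrite z1.
have -> : normc ((G * q * 'X^(2 ^ k - n)).[z] - phi z) =
    normc (G.[z] * ((q * 'X^(2 ^ k)).[z] - 1) + (G.[z] - z ^+ n * phi z)).
  rewrite -[LHS]mul1r -(expr1n R n) -z1 -normcXn -normcM; congr normc.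
  rewrite mulrBr !hornerM !hornerXn -{2}(subnK nk) exprD; ring.
apply: le_trans (normcD _ _) _; rewrite normcM.
apply: le_trans (lerD (ler_pM (normc_ge0 _) (normc_ge0 _) nG (le_trans hq hk)) hG) _.
rewrite [X in _ <= X](splitr e) lerD2r mulrCA ler_piMr ?(ltW e2) // ler_pdivrMr; lra.
Qed.

(** Rational coordinates make the family of target polynomials countable while keeping it dense. *)
Definition ratc (x : rat * rat) : C := ratr x.1 +i* ratr x.2.

Definition rat_poly (l : seq (rat * rat)) : {poly C} := Poly [seq ratc x | x <- l].

Lemma rat_poly_dense (p : {poly C}) (e : R) : 0 < e ->
  exists l, coef_norm 1 (p - rat_poly l) <= e.
Proof.
elim/poly_ind: p e => [|p c IH] e e0.
  by exists [::]; rewrite /rat_poly /= subr0 coef_norm0 ltW.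
have e2 : 0 < e / 2 by rewrite divr_gt0.
have e4 : 0 < e / 4 by rewrite divr_gt0.
have [l hl] := IH _ e2.
have near (x : R) : exists a : rat, `|x - ratr a| <= e / 4.
  have [a] : exists a : rat, ratr a \in `](x - e / 4), (x + e / 4)[.
    by apply: rat_in_itvoo; lra.
  by rewrite in_itv /= => /andP[a1 a2]; exists a; rewrite ler_norml; apply/andP; split; lra.
have [a ha] := near (complex.Re c); have [b hb] := near (complex.Im c).
exists ((a, b) :: l).
have -> : p * 'X + c%:P - rat_poly ((a, b) :: l) =
    (p - rat_poly l) * 'X + (c - ratc (a, b))%:P.
  by rewrite /rat_poly /= cons_poly_def polyCB; ring.
rewrite coef_norm_cons mulr1.
have : normc (c - ratc (a, b)) <= e / 4 + e / 4.
  apply: (le_trans (normc_leReIm _)); case: (c) ha hb => x y /= ha hb; exact: lerD.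
lra.
Qed.

End Density.

(** * Choosing the shift by averaging *)

Section Pigeonhole.
Variable R : realType.
Local Notation C := R[i].
Local Notation mu := (@lebesgue_measure R).
Local Notation I := (`[0, 2 * pi[%classic : set R).

Definition small_set (F : {poly C}) (A : R) : set R :=
  I `&` [set t | normc F.[expi t] <= A].

Lemma measurable_circle_poly (F : {poly C}) :
  measurable_fun setT (fun t : R => complex.Re F.[expi t]) /\
  measurable_fun setT (fun t : R => complex.Im F.[expi t]).
Proof.
have mcos : measurable_fun setT (@cos R).
  by apply: continuous_measurable_fun; exact: continuous_cos.
have msin : measurable_fun setT (@sin R).
  by apply: continuous_measurable_fun; exact: continuous_sin.
elim/poly_ind: F => [|F c [IH1 IH2]].
  by split; [apply: eq_measurable_fun (@measurable_cst _ _ _ _ setT (0 : R))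
            |apply: eq_measurable_fun (@measurable_cst _ _ _ _ setT (0 : R))]
     => t _; rewrite horner0.
have e1 (t : R) : complex.Re (F * 'X + c%:P).[expi t] =
    complex.Re F.[expi t] * cos t - complex.Im F.[expi t] * sin t + complex.Re c.
  by rewrite hornerMXaddC; case: (F.[_]) => x y; case: (c).
have e2 (t : R) : complex.Im (F * 'X + c%:P).[expi t] =
    complex.Re F.[expi t] * sin t + complex.Im F.[expi t] * cos t + complex.Im c.
  by rewrite hornerMXaddC; case: (F.[_]) => x y; case: (c).
split; [under eq_fun do rewrite e1|under eq_fun do rewrite e2].
- apply: measurable_funD => //; apply: measurable_funB; exact: measurable_funM.
- apply: measurable_funD => //; apply: measurable_funD; exact: measurable_funM.
Qed.

Lemma measurable_small_set (F : {poly C}) (A : R) : 0 <= A -> measurable (small_set F A).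
Proof.
move=> A0; apply: measurableI => //.
have [m1 m2] := measurable_circle_poly F.
pose g (t : R) := complex.Re F.[expi t] ^+ 2 + complex.Im F.[expi t] ^+ 2.
have mg : measurable_fun setT g.
  by apply: measurable_funD; exact: measurable_funX.
have -> : [set t | normc F.[expi t] <= A] = g @^-1` `]-oo, A ^+ 2].
  apply/seteqP; split => t /=; rewrite in_itv /= /g; case: (F.[_]) => x y /= h.
    rewrite -[X in X <= _]sqr_sqrtr ?addr_ge0 ?sqr_ge0 //.
    by rewrite lerXn2r ?nnegrE ?sqrtr_ge0.
  by rewrite -(ler_pXn2r (n := 2)) ?nnegrE ?sqrtr_ge0 // sqr_sqrtr ?addr_ge0 ?sqr_ge0.
by rewrite -[X in measurable X]setTI; apply: mg.
Qed.

(** Since |z^m| = 1 and c > 2A, distinct shifts have disjoint small sets for each fixed [j], of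
    total measure at most 2 pi; this is the source of the bound. *)
Lemma pigeonhole_shift (D L m : nat) (F : nat -> {poly C}) (A c : R) :
  0 <= A -> 2 * A < c -> (0 < L)%N ->
  exists2 l : nat, (l < L)%N &
    (mu (\big[setU/set0]_(j < D) small_set (F j + (l%:R * c)%:C *: 'X^m) A)
      <= (D%:R * (2 * pi) / L%:R)%:E)%E.
Proof.
move=> A0 Ac L0.
pose B (j l : nat) := small_set (F j + (l%:R * c)%:C *: 'X^m) A.
have mB j l : measurable (B j l) by exact: measurable_small_set.
have pi0 : 0 < 2 * pi :> R by rewrite mulr_gt0 ?pi_gt0.
have muI : (mu I = (2 * pi)%:E)%E.
  by rewrite lebesgue_measure_itv /= lte_fin pi0 oppr0 addr0.
have c0 : 0 < c by lra.
have triv j : trivIset setT (B j).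
  apply/trivIsetP => l l' _ _ ll'; apply/seteqP; split => // t [[It h1] [_ h2]].
  move: h1 h2 => /=; rewrite !hornerD !hornerZ !hornerXn; set x := (F j).[_].
  set z := expi t ^+ m => h1 h2.
  have z1 : normc z = 1 by rewrite normcXn normc_expi expr1n.
  have h3 : `|l%:R * c - l'%:R * c| <= 2 * A.
    have -> : `|l%:R * c - l'%:R * c| = normc ((l%:R * c - l'%:R * c)%:C * z).
      by rewrite normcM normc_real z1 mulr1.
    have -> : (l%:R * c - l'%:R * c)%:C * z = (x + (l%:R * c)%:C * z) - (x + (l'%:R * c)%:C * z).
      by rewrite rmorphB /=; ring.
    by apply: le_trans (normcB _ _) _; lra.
  have h4 : 1 <= `|l%:R - l'%:R : R|.
    have -> : `|l%:R - l'%:R : R| = `|(l%:Z - l'%:Z)%R|%:~R.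
      by rewrite intr_norm rmorphB.
    rewrite ler1z -gtz0_ge1 normr_gt0 subr_eq0.
    by apply: contra ll' => /eqP[->].
  rewrite -mulrBl normrM (gtr0_norm c0) in h3; nra.
have sumB j : (\sum_(l < L) mu (B j l) <= (2 * pi)%:E)%E.
  rewrite -measure_bigsetU //; last by move=> l; exact: mB.
  rewrite -muI; apply: le_measure; rewrite ?inE //.
    by apply: bigsetU_measurable => l _; exact: mB.
  by rewrite -bigcup_mkord => t [l _ []].
apply: contrapT => h.
have {}h (l : 'I_L) : ((D%:R * (2 * pi) / L%:R)%:E < \sum_(j < D) mu (B j l))%E.
  rewrite ltNge; apply/negP => hl; apply: h; exists l => //.
  apply: le_trans hl.
  apply: (@content_subadditive _ R _ mu _ (fun j => B j l) D) => // [k _|].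
    exact: mB.
  by apply: bigsetU_measurable => j _; exact: mB.
have : (\sum_(l < L) \sum_(j < D) mu (B j l) <= (D%:R * (2 * pi))%:E)%E.
  rewrite exchange_big /=.
  apply: (le_trans (lee_sum _ (fun (j : 'I_D) _ => sumB j))).
  by rewrite sumEFin sumr_const card_ord -(mulr_natl (2 * pi) D).
apply/negP; rewrite -ltNge.
have -> : D%:R * (2 * pi) = \sum_(l < L) (D%:R * (2 * pi) / L%:R) :> R.
  by rewrite sumr_const card_ord -[RHS]mulr_natr divfK // pnatr_eq0 -lt0n.
rewrite -sumEFin; case: L L0 h {sumB} => // L _ h.
rewrite !big_ord_recl; apply: lte_leD => //; first by rewrite sumEFin.
by apply: lee_sum => i _; exact/ltW.
Qed.

End Pigeonhole.

(** * One stage of the construction *)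

Section Stage.
Variable R : realType.
Local Notation C := R[i].
Local Notation mu := (@lebesgue_measure R).
Local Notation I := (`[0, 2 * pi[%classic : set R).

(** Taking r close to 1 makes P(rz) close to P(z), so the correction T = p - P can be formed without
    dilating [P]. *)
Lemma dilation_lipschitz (p : {poly C}) : exists2 M : R, 0 <= M &
  forall (r : R) z, 0 <= r <= 1 -> normc z = 1 ->
    normc (p.[r%:C * z] - p.[z]) <= M * (1 - r).
Proof.
elim/poly_ind: p => [|p c [M M0 hM]].
  by exists 0 => // r z _ _; rewrite !horner0 subrr normc0 mul0r.
exists (M + coef_norm 1 p); first by rewrite addr_ge0 ?coef_norm_ge0.
move=> r z r01 z1; have [r0 r1] := andP r01.
rewrite !hornerMXaddC.
have -> : p.[r%:C * z] * (r%:C * z) + c - (p.[z] * z + c) =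
  (p.[r%:C * z] - p.[z]) * (r%:C * z) + p.[z] * ((r - 1)%:C * z).
  by rewrite rmorphB /=; ring.
apply: le_trans (normcD _ _) _; rewrite !normcM !normc_real z1 !mulr1.
rewrite (ger0_norm r0) ler0_norm ?subr_le0 // opprB.
have h1 := hM r z r01 z1.
have h2 : normc p.[z] <= coef_norm 1 p by apply: normc_horner; rewrite z1.
have := normc_ge0 (p.[r%:C * z] - p.[z]); nra.
Qed.

(** Finitely many truncations settle all J >= m: from degree D - 1 on the truncation of [P] is [P]
    itself, and the shift is present in every truncation from [m] on. *)
Lemma bigU_take_poly_large (D m J : nat) (P : {poly C}) (A t : R) :
  (size P <= D)%N -> (0 < D)%N -> I t -> (m <= J)%N -> forall a : C,
  ~ (\big[setU/set0]_(j < D) small_set (take_poly j.+1 P + a *: 'X^m) A) t ->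
  A <= normc (take_poly J.+1 (P + a *: 'X^m)).[expi t].
Proof.
move=> PD D0 It mJ a.
rewrite -(bigcup_mkord D (fun j => small_set (take_poly j.+1 P + a *: 'X^m) A)) => nB.
have -> : take_poly J.+1 (P + a *: 'X^m) = take_poly J.+1 P + a *: 'X^m.
  by rewrite take_polyD take_polyZ (@take_poly_id _ _ 'X^m) // size_polyXn.
pose j := minn J D.-1.
have -> : take_poly J.+1 P = take_poly j.+1 P.
  rewrite /j; case: (leqP J D.-1) => // h.
  by rewrite !take_poly_id //; move: PD D0 h; lia.
rewrite leNgt; apply/negP => h; apply: nB; exists j.
  by rewrite /= /j -(prednK D0) ltnS geq_minr.
by split=> //=; exact: ltW.
Qed.

(** Here [s] is the last radius in use, where the change must stay small. The radius [r] and the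
    constant [c] are fixed before [k], which can then be taken large with respect to both; every
    error is kept below e/4. *)
Lemma stage (rho : nat -> R) (P p : {poly C}) (s A e d : R) (th : C) (n0 m0 : nat) :
  (forall n, 0 <= rho n < 1) -> rho @ \oo --> (1 : R) ->
  0 <= s < 1 -> 0 <= A -> 0 < e -> 0 < d -> normc th = 1 ->
  exists (P' : {poly C}) (n m : nat) (B : set R),
    [/\ [/\ (n0 <= n)%N, (m0 <= m)%N & s <= rho n],
     take_poly m P' = P /\ coef_norm s (P' - P) <= e,
     forall z, arc th d z -> normc (P'.[(rho n)%:C * z] - p.[z]) <= e,
     measurable B /\ (mu B <= e%:E)%E &
     forall t, I t -> ~ B t -> forall J, (m <= J)%N ->
       A <= normc (take_poly J.+1 P').[expi t]].
Proof.
move=> rho01 rho1 s01 A0 e0 d0 th1; have [s0 s1] := andP s01.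
(* w will be small on |z| <= s', hence w(z/r) on |z| <= s as soon as s/r <= s'. *)
pose s' := (s + 1) / 2.
have s'01 : 0 <= s' < 1 by rewrite /s'; apply/andP; split; lra.
have s'0 : 0 < s' by rewrite /s'; lra.
have ss' : s < s' by rewrite /s'; lra.
have [c hc] := sharp_separating_poly s'01 d0 th1.
have [M M0 hM] := dilation_lipschitz P.
have e4 : 0 < e / 4 by rewrite divr_gt0.
have e5 : 0 < e / 4 / (M + 1) by rewrite divr_gt0 //; lra.
(* The three entries ensure, in turn, s/r <= s', r > 0 and the dilation error M (1 - r) <= e/4. *)
pose b := Num.max (s / s') (Num.max (2^-1) (1 - e / 4 / (M + 1))).
have b1 : b < 1.
  by rewrite !gt_max ltr_pdivrMr // mul1r ss' invf_lt1 ?ltr1n //= ltrBlDr ltrDl.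
have [n [n0n hn]] : exists n, (n0 <= n)%N /\ b <= rho n.
  have d1 : 0 < 1 - b by rewrite subr_gt0.
  have /cvgrPdist_le/(_ _ d1)[N _ hN] := rho1.
  exists (maxn n0 N); split; first exact: leq_maxl.
  have := hN (maxn n0 N) (leq_maxr _ _) => /ler_normlP[_]; lra.
have [r0 r1] := andP (rho01 n); set r := rho n in r0 r1 hn *.
move: hn; rewrite /b !ge_max => /and3P[hr1 hr2 hr3].
have {}r0 : 0 < r by apply: lt_le_trans hr2; rewrite invr_gt0.
have sr : s <= r.
  by apply: le_trans hr1; rewrite ler_pdivlMr // ler_piMr // ltW //; case/andP: s'01.
have sr' : s / r <= s' by rewrite ler_pdivrMr // mulrC -ler_pdivrMr.
pose T := p - P; pose tau := coef_norm 1 T.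
have tau0 : 0 <= tau by exact: coef_norm_ge0.
(* With L = D Q the averaging bound becomes 2 pi / Q <= e, whatever D is. *)
have [Q [hQ Q0]] := exists_nat_ge (2 * pi / e).
pose cc := 2 * A + 1; have cc0 : 0 < cc by rewrite /cc; lra.
(* Absorbs the sizes of [T] and [P] into the coefficient of 3^k, so that D0 3^k bounds the size of
   the polynomial before the shift. *)
pose D0 := (c + size T + size P + 1)%N.
have D0p : (0 < D0)%N by rewrite /D0 addn1.
pose cst : R := (D0 * Q)%:R * cc.
have cst0 : 0 < cst by rewrite mulr_gt0 // ltr0n muln_gt0 D0p.
have r01 : 0 <= r < 1 by rewrite ltW.
have e6 : 0 < e / 4 / cst by rewrite divr_gt0.
have [k1 hk1] := exp3_exp2_small r01 e6.
have q01 : 0 <= (4^-1 : R) < 1 by rewrite invr_ge0 ler0n invf_lt1 ?ltr1n.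
have e7 : 0 < e / 4 / (tau + 1) by rewrite divr_gt0 //; lra.
have [k2 hk2] := expn_small q01 e7.
pose k := maxn (maxn k1 k2) (maxn (size P) m0).
have {}hk1 := hk1 k (leq_trans (leq_maxl k1 k2) (leq_maxl _ _)).
have {}hk2 := hk2 k (leq_trans (leq_maxr k1 k2) (leq_maxl _ _)).
have km : (k <= 2 ^ k)%N by exact/ltnW/ltn_expl.
have Pm : (size P <= 2 ^ k)%N.
  by rewrite (leq_trans _ km) // (leq_trans (leq_maxl _ _) (leq_maxr _ _)).
have m0m : (m0 <= 2 ^ k)%N.
  by rewrite (leq_trans _ km) // (leq_trans (leq_maxr _ _) (leq_maxr _ _)).
have [q /= [q1 q2 q3]] := hc k; set m := (2 ^ k)%N in hk1 km Pm m0m q1 q2 q3.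
pose B1 := (T * q * 'X^m) \Po ((r^-1)%:C *: 'X).
have rC : (r^-1)%:C * r%:C = 1 :> C by rewrite -rmorphM /= mulVf ?gt_eqF.
have B1X : exists B2, B1 = B2 * 'X^m.
  exists ((r^-1)%:C ^+ m *: ((T * q) \Po ((r^-1)%:C *: 'X))).
  by rewrite /B1 comp_polyM comp_Xn_poly exprZn -scalerAl -scalerAr.
pose D := (D0 * 3 ^ k)%N.
have D_gt0 : (0 < D)%N by rewrite muln_gt0 D0p expn_gt0.
have sPB : (size (P + B1)%R <= D)%N.
  have k3 : (1 <= 3 ^ k)%N by rewrite expn_gt0.
  have sB : (size B1 <= (size T + size (q * 'X^m)%R).+1)%N.
    apply: leq_trans (size_comp_poly_leq _ _) _; rewrite ltnS.
    apply: leq_trans (_ : ((size (T * q * 'X^m)%R).-1 * 1 <= _)%N).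
      rewrite leq_mul2l; apply/orP; right.
      rewrite -subn1 leq_subLR; apply: leq_trans (size_scale_leq _ _) _.
      by rewrite size_polyX.
    rewrite muln1 -mulrA; apply: leq_trans (leq_pred _) _.
    by apply: leq_trans (size_polyMleq _ _) _; exact: leq_pred.
  apply: leq_trans (size_polyD _ _) _; rewrite geq_max /D /D0 !mulnDl mul1n.
  apply/andP; split.
    apply: leq_trans (leq_pmulr (size P) k3) _.
    exact: leq_trans (leq_addl _ _) (leq_addr _ _).
  apply: (leq_trans sB); rewrite -addn1; apply: (leq_add _ k3).
  apply: leq_trans (leq_addr _ _); rewrite addnC; apply: leq_add => //.
  exact: (leq_pmulr _ k3).
pose L := (D * Q)%N.
have L0 : (0 < L)%N by rewrite muln_gt0 D_gt0.
have Acc : 2 * A < cc by rewrite /cc; lra.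
have [l lL hl] := @pigeonhole_shift R D L m (fun j => take_poly j.+1 (P + B1)) A cc A0 Acc L0.
set a := (l%:R * cc)%:C in hl; set B := \big[setU/set0]_(j < D) _ in hl.
exists (P + B1 + a *: 'X^m), n, m, B.
(* The averaging does not reveal [l]; l < L suffices, and L cc r^m is [cst] times 3^k r^m. *)
have na : normc a * r ^+ m <= e / 4.
  rewrite normc_real ger0_norm ?mulr_ge0 ?(ltW cc0) //.
  apply: le_trans (_ : L%:R * cc * r ^+ m <= _).
    by rewrite ler_wpM2r ?exprn_ge0 ?(ltW r0) // ler_wpM2r ?(ltW cc0) // ler_nat ltnW.
  have -> : L%:R * cc * r ^+ m = cst * (3 ^+ k * r ^+ m).
    by rewrite /L /D /cst !natrM natrX; ring.
  by move: hk1; rewrite ler_pdivlMr // mulrC.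
have tau4 : tau * 4^-1 ^+ k <= e / 4.
  move: hk2; rewrite ler_pdivlMr; last by lra.
  have : 0 <= (4^-1 : R) ^+ k by rewrite exprn_ge0 // invr_ge0.
  nra.
split.
- by split.
- split.
    have [B2 ->] := B1X.
    by rewrite -addrA -mul_polyC -mulrDl take_polyDMXn.
  have -> : P + B1 + a *: 'X^m - P = B1 + a *: 'X^m by rewrite -(addrA P) addrAC subrr add0r.
  apply: le_trans (coef_normD _ _ s0) _.
  have h1 : coef_norm s (a *: 'X^m) <= e / 4.
    rewrite coef_normZ -['X^m]mul1r coef_normMXn coef_normC normc1 mul1r.
    apply: le_trans na; rewrite ler_wpM2l ?normc_ge0 //.
    by rewrite lerXn2r ?nnegrE // ltW.
  have h2 : coef_norm s B1 <= e / 4.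
    rewrite coef_norm_scaleX normc_real ger0_norm ?invr_ge0 ?(ltW r0) //.
    apply: le_trans (ler_coef_norm (t := s') _ _ _) _.
    + by rewrite mulr_ge0 // invr_ge0 ltW.
    + by rewrite mulrC.
    rewrite -mulrA; apply: le_trans (coef_normM _ _ (ltW s'0)) _.
    apply: le_trans tau4; apply: ler_pM => //; try exact: coef_norm_ge0 (ltW s'0).
    by apply: ler_coef_norm; rewrite ltW //; case/andP: s'01.
  lra.
- move=> z Kz; have z1 : normc z = 1 by case: Kz.
  have B1z : B1.[r%:C * z] = T.[z] * (q * 'X^m).[z].
    by rewrite horner_comp hornerZ hornerX mulrA rC mul1r -mulrA hornerM.
  have -> : (P + B1 + a *: 'X^m).[r%:C * z] - p.[z] =
      (P.[r%:C * z] - P.[z]) + (T.[z] * ((q * 'X^m).[z] - 1)) + a * (r%:C * z) ^+ m.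
    have Tz : T.[z] = p.[z] - P.[z] by rewrite hornerD hornerN.
    by rewrite hornerD (hornerD P) B1z hornerZ hornerXn Tz; ring.
  have h1 := normcD ((P.[r%:C * z] - P.[z]) + (T.[z] * ((q * 'X^m).[z] - 1))) (a * (r%:C * z) ^+ m).
  have h2 := normcD (P.[r%:C * z] - P.[z]) (T.[z] * ((q * 'X^m).[z] - 1)).
  have h3 : normc (a * (r%:C * z) ^+ m) <= e / 4.
    by rewrite normcM normcXn normcM z1 mulr1 normc_real gtr0_norm.
  have h4 : normc (P.[r%:C * z] - P.[z]) <= e / 4.
    apply: (le_trans (hM r z _ z1)); first by rewrite !ltW.
    have h5 : (1 - r) * (M + 1) <= e / 4.
      by rewrite -ler_pdivlMr ?ltr_wpDl // lerBlDr addrC -lerBlDr.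
    by apply: le_trans h5; rewrite [(1 - r) * _]mulrDr mulr1 mulrC lerDl subr_ge0 ltW.
  have h5 : normc (T.[z] * ((q * 'X^m).[z] - 1)) <= e / 4.
    rewrite normcM; apply: le_trans tau4; apply: ler_pM; rewrite ?normc_ge0 //.
      by apply: normc_horner; rewrite z1.
    exact: q3.
  lra.
- split.
    by apply: bigsetU_measurable => j _; exact: measurable_small_set.
  apply: (le_trans hl); rewrite lee_fin /L natrM.
  have -> : D%:R * (2 * pi) / (D%:R * Q%:R) = 2 * pi / Q%:R :> R.
    by field; rewrite !pnatr_eq0 -!lt0n D_gt0 Q0.
  by move: hQ; rewrite !ler_pdivrMr ?ltr0n // (mulrC e).
- move=> t It nB J mJ.
  by apply: (bigU_take_poly_large sPB D_gt0 It mJ nB).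
Qed.

End Stage.

(** * Convergence of the limit series *)

Lemma coef_norm_trunc (R : realType) (s : R) (p : {poly R[i]}) N : 0 <= s ->
  \sum_(i < N) normc p`_i * s ^+ i <= coef_norm s p.
Proof.
move=> s0; rewrite (coef_norm_widen s (leq_maxr N (size p))).
rewrite (big_ord_widen _ (fun i => normc p`_i * s ^+ i) (leq_maxl N (size p))).
rewrite big_mkcond /=; apply: ler_sum => i _; case: ifP => // _.
by rewrite mulr_ge0 ?normc_ge0 ?exprn_ge0.
Qed.

Lemma cvg_series_complex (R : realType) (u : nat -> R[i]) (M : R) :
  (forall N, \sum_(i < N) normc (u i) <= M) -> cvgn (series u).
Proof.
move=> hM.
have key (v : nat -> R) : (forall i, `|v i| <= normc (u i)) -> cvgn (series v).
  move=> vu; apply: normed_cvg; apply: nondecreasing_is_cvgn.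
    apply/nondecreasing_seqP => n /=.
    by rewrite /series /= big_nat_recr //= lerDl.
  exists M => _ [n _ <-] /=; rewrite /series /= big_mkord.
  by apply: le_trans (hM n); apply: ler_sum.
have [/cvg_ex[x hx] /cvg_ex[y hy]] :
    cvgn (series (fun i => complex.Re (u i))) /\ cvgn (series (fun i => complex.Im (u i))).
  by split; apply: key => i; [exact: normc_Re|exact: normc_Im].
apply/cvg_ex; exists (x +i* y); apply/cvg_normcP => e e0.
have e2 : 0 < e / 2 by rewrite divr_gt0.
have /cvgrPdist_lt/(_ _ e2) h1 := hx; have /cvgrPdist_lt/(_ _ e2) h2 := hy.
near=> n.
have -> : x +i* y - series u n =
    (x - series (fun i => complex.Re (u i)) n) +i* (y - series (fun i => complex.Im (u i)) n).
  rewrite /series /=.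
  have -> : \sum_(0 <= k < n) u k =
     (\sum_(0 <= k < n) complex.Re (u k)) +i* (\sum_(0 <= k < n) complex.Im (u k)).
    elim: (n) => [|m IH]; first by rewrite !big_nil.
    by rewrite !big_nat_recr //= IH; case: (u m).
  by [].
apply: (le_lt_trans (normc_leReIm _)) => /=.
have a1 : `|x - series (fun i => complex.Re (u i)) n| < e / 2 by near: n.
have a2 : `|y - series (fun i => complex.Im (u i)) n| < e / 2 by near: n.
lra.
Unshelve. all: by end_near.
Qed.

(** * Enumeration of the tasks and the inductive construction *)

Section Construction.
Variables (R : realType) (rho : nat -> R).
Hypotheses (rho01 : forall n, 0 <= rho n < 1).
Hypothesis (rho_incr : {homo rho : i j / (i < j)%N >-> i < j}).
Hypothesis (rho1 : rho @ \oo --> (1 : R)).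
Local Notation C := R[i].
Local Notation mu := (@lebesgue_measure R).
Local Notation I := (`[0, 2 * pi[%classic : set R).

(** Angle of the centre, gap index and coefficients of the target: a countable type, hence
    enumerable through [pickle]. *)
Definition task := (rat * nat * seq (rat * rat))%type.

(* Every task occurs at infinitely many stages: [logn 2] is onto with infinite fibres. *)
Definition task_at (k : nat) : task :=
  odflt (0%R, 0%N, [::]) (unpickle (logn 2 k)).

Lemma task_at_often (x : task) (k0 : nat) : exists2 k, (k0 <= k)%N & task_at k = x.
Proof.
(* The factor 3^k0 makes the stage late without changing the 2-adic valuation. *)
exists (2 ^ pickle x * 3 ^ k0)%N.
  by rewrite (leq_trans (ltnW (@ltn_expl 3 k0 isT))) // leq_pmull // expn_gt0.
rewrite /task_at lognM ?expn_gt0 // pfactorK // (@lognX 2) (@logn_coprime 2 3) // muln0 addn0.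
by rewrite pickleK.
Qed.

Definition task_center (x : task) : C := expi (ratr x.1.1).
Definition task_gap (x : task) : R := x.1.2.+1%:R^-1.
Definition task_poly (x : task) : {poly C} := rat_poly R x.2.

Definition state := ({poly C} * nat * nat)%type.

(** Stage [k] demands height [k], with error and exceptional measure 2^-k; the preceding radius
    [rho n] is the one at which the change is measured. *)
Definition step (k : nat) (u v : state) (B : set R) : Prop :=
  let: (P, n, m) := u in let: (P', n', m') := v in
  [/\ (n < n')%N /\ (m < m')%N,
      take_poly m' P' = P /\ coef_norm (rho n) (P' - P) <= 2^-1 ^+ k,
      forall z, arc (task_center (task_at k)) (task_gap (task_at k)) z ->
        normc (P'.[(rho n')%:C * z] - (task_poly (task_at k)).[z]) <= 2^-1 ^+ k,
      measurable B /\ (mu B <= (2^-1 ^+ k)%:E)%E &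
      forall t, I t -> ~ B t -> forall J, (m' <= J)%N ->
        k%:R <= normc (take_poly J.+1 P').[expi t]].

Lemma step_exists (k : nat) (u : state) : exists v : state * set R, step k u v.1 v.2.
Proof.
case: u => [[P n] m].
have k0 : 0 <= k%:R :> R by [].
have e0 : 0 < 2^-1 ^+ k :> R by rewrite exprn_gt0 // invr_gt0.
have d0 : 0 < task_gap (task_at k) by rewrite invr_gt0.
have [P' [n' [m' [B [[h1 h2 h3] h4 h5 h6 h7]]]]] :=
  @stage R rho P (task_poly (task_at k)) (rho n) _ _ _
    (task_center (task_at k)) n.+1 m.+1 rho01 rho1 (rho01 n) k0 e0 d0
    (normc_expi _).
by exists ((P', n', m'), B).
Qed.

Lemma construction : exists (P : nat -> {poly C}) (n m : nat -> nat) (B : nat -> set R),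
  forall k, step k (P k, n k, m k) (P k.+1, n k.+1, m k.+1) (B k).
Proof.
have /choice[f hf] : forall x : nat * state, exists v : state * set R, step x.1 x.2 v.1 v.2.
  by move=> [k u]; exact: step_exists.
pose st := fix st (k : nat) : state :=
  if k is k'.+1 then (f (k', st k')).1 else (0, 0%N, 0%N).
exists (fun k => (st k).1.1), (fun k => (st k).1.2), (fun k => (st k).2),
  (fun k => (f (k, st k)).2) => k.
have := hf (k, st k); rewrite -[(f (k, st k)).1]/(st k.+1).
by case: (st k) => [[? ?] ?]; case: (st k.+1) => [[? ?] ?].
Qed.

(** * The limit function and its two properties *)

Section Limit.
Variables (P : nat -> {poly C}) (n m : nat -> nat) (B : nat -> set R).
Hypothesis H : forall k, step k (P k, n k, m k) (P k.+1, n k.+1, m k.+1) (B k).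

(** The diagonal choice is safe: stages j and j + 1 agree below degree m (j+1), which exceeds j. *)
Definition limit_coef (i : nat) : C := (P i.+1)`_i.
Local Notation a := limit_coef.

Lemma index_ge k : (k <= n k)%N /\ (k <= m k)%N.
Proof.
elim: k => [//|k [h1 h2]]; have [[h3 h4] _ _ _ _] := H k.
by split; [exact: leq_ltn_trans h3|exact: leq_ltn_trans h4].
Qed.

Lemma index_homo j k : (j <= k)%N -> (n j <= n k)%N /\ (m j <= m k)%N.
Proof.
elim: k => [|k IH]; first by rewrite leqn0 => /eqP ->.
rewrite leq_eqVlt => /orP[/eqP -> //|]; rewrite ltnS => /IH [h1 h2].
have [[h3 h4] _ _ _ _] := H k.
by split; [exact: leq_trans h1 (ltnW h3)|exact: leq_trans h2 (ltnW h4)].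
Qed.

(** [P k] is the truncation of [P k.+1] at [m k.+1]. The range therefore reaches [m k.+1]: the zeros
    between the degree of [P k] and that bound are final too. *)
Lemma coef_stable k j i : (k <= j)%N -> (i < m k.+1)%N -> (P j)`_i = (P k)`_i.
Proof.
move=> kj im; elim: j kj => [|j IH]; first by rewrite leqn0 => /eqP ->.
rewrite leq_eqVlt => /orP[/eqP <- //|]; rewrite ltnS => kj.
rewrite -(IH kj); have [_ [h _] _ _ _] := H j.
rewrite -[in RHS]h coef_take_poly; case: ifP => // /negbT.
by rewrite -leqNgt => mi; have [_ h2] := @index_homo k.+1 j.+1 kj; move: im; lia.
Qed.

Lemma limit_coefE k i : (i < m k.+1)%N -> a i = (P k)`_i.
Proof.
move=> im; have [h|h] := leqP k i.+1; first exact: coef_stable.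
rewrite /limit_coef; apply/esym/coef_stable; first exact: ltnW.
by have [_] := index_ge i.+2; lia.
Qed.

Lemma partial_sumE k J z : (J < m k.+1)%N -> partial_sum a J z = (take_poly J.+1 (P k)).[z].
Proof.
move=> Jm; rewrite /partial_sum /take_poly horner_poly big_mkord.
apply: eq_bigr => i _; rewrite (@limit_coefE k) //.
by have := ltn_ord i; lia.
Qed.

Lemma rho_homo i j : (i <= j)%N -> rho i <= rho j.
Proof. by rewrite leq_eqVlt => /orP[/eqP -> //|/rho_incr/ltW]. Qed.

(** Later increments are measured at radii no smaller than [rho (n k)], so monotonicity brings them
    back to it; the difference of powers of 1/2 is their geometric sum. *)
Lemma increment_norm k j : (k <= j)%N ->
  coef_norm (rho (n k)) (P j - P k) <= 2 * (2^-1 ^+ k - 2^-1 ^+ j).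
Proof.
have s0 : 0 <= rho (n k) by case/andP: (rho01 (n k)).
elim: j => [|j IH]; first by rewrite leqn0 => /eqP ->; rewrite !subrr coef_norm0 mulr0.
rewrite leq_eqVlt => /orP[/eqP <- //|]; first by rewrite !subrr coef_norm0 mulr0.
rewrite ltnS => kj; have [_ [_ h] _ _ _] := H j.
have -> : P j.+1 - P k = (P j.+1 - P j) + (P j - P k) by rewrite addrA subrK.
apply: le_trans (coef_normD _ _ s0) _.
have h1 : coef_norm (rho (n k)) (P j.+1 - P j) <= 2^-1 ^+ j.
  apply: le_trans h; apply: ler_coef_norm => //; apply: rho_homo.
  by have [] := index_homo kj.
have := IH kj; rewrite exprS; lra.
Qed.

(** The first [N] coefficients of the limit are those of stage max(k, N), so a difference of two
    stages gives a bound uniform in [N]. *)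
Lemma tail_norm k N :
  \sum_(i < N) normc (a i - (P k)`_i) * rho (n k) ^+ i <= 2 * 2^-1 ^+ k.
Proof.
have s0 : 0 <= rho (n k) by case/andP: (rho01 (n k)).
pose j := maxn k N.
have -> : \sum_(i < N) normc (a i - (P k)`_i) * rho (n k) ^+ i =
          \sum_(i < N) normc (P j - P k)`_i * rho (n k) ^+ i.
  apply: eq_bigr => i _; rewrite coefB (@limit_coefE j) //.
  by have [_] := index_ge j.+1; have := ltn_ord i; have := leq_maxr k N; rewrite -/j; lia.
apply: le_trans (coef_norm_trunc _ _ s0) _.
apply: le_trans (increment_norm (leq_maxl k N)) _.
have : 0 <= (2^-1 : R) ^+ j by rewrite exprn_ge0 // invr_ge0.
lra.
Qed.

Lemma limit_cvg k z : normc z <= rho (n k) -> cvgn (series (fun i => a i * z ^+ i)).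
Proof.
move=> zr; have s0 : 0 <= rho (n k) by case/andP: (rho01 (n k)).
apply: (@cvg_series_complex _ _ (2 * 2^-1 ^+ k + coef_norm (rho (n k)) (P k))) => N.
apply: le_trans (lerD (tail_norm k N) (coef_norm_trunc (P k) N s0)).
rewrite -big_split /=; apply: ler_sum => i _.
rewrite -mulrDl normcM normcXn; apply: ler_pM; rewrite ?normc_ge0 ?exprn_ge0 ?normc_ge0 //.
  by apply: le_trans (normcD _ _); rewrite subrK.
by rewrite lerXn2r ?nnegrE ?normc_ge0.
Qed.

Lemma limit_close k z : normc z <= rho (n k) ->
  normc (pseries_val a z - (P k).[z]) <= 2 * 2^-1 ^+ k.
Proof.
move=> zr; apply/ler_addgt0Pr => e e0.
have /cvg_normcP/(_ _ e0)[N0 _ hN] := limit_cvg zr.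
pose N := maxn N0 (size (P k)).
have {}hN := hN N (leq_maxl _ _).
apply: le_trans (normc_triangle (series (fun i => a i * z ^+ i) N) _ _) _.
rewrite addrC; apply: lerD; last exact: ltW.
apply: le_trans (tail_norm k N).
rewrite (horner_coef_wide _ (leq_maxr N0 (size (P k)))) -/N /series /= big_mkord -sumrB.
apply: le_trans (normc_sum _ _ _) _; apply: ler_sum => i _.
rewrite -mulrBl normcM normcXn ler_wpM2l ?normc_ge0 //.
by rewrite lerXn2r ?nnegrE ?normc_ge0 // (le_trans _ zr) ?normc_ge0.
Qed.

Lemma limit_holo : holo_disc a.
Proof.
move=> z z1; have d0 : 0 < 1 - normc z by rewrite subr_gt0.
have /cvgrPdist_le/(_ _ d0)[N _ hN] := rho1.
apply: (@limit_cvg N); have := hN N (leqnn N) => /ler_normlP[_] h.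
by have [+ _] := index_ge N => /rho_homo; lra.
Qed.

(** Stage k + 1 meets task k within 2^-k at this radius, and all later changes add at most twice
    2^-(k+1) there. *)
Lemma limit_dilate_approx k z :
  arc (task_center (task_at k)) (task_gap (task_at k)) z ->
  normc (dilate a (rho (n k.+1)) z - (task_poly (task_at k)).[z]) <= 2 * 2^-1 ^+ k.
Proof.
move=> Kz; have [z1 _] := Kz; have [_ _ h _ _] := H k.
apply: le_trans (normc_triangle (P k.+1).[(rho (n k.+1))%:C * z] _ _) _.
have h1 := h z Kz.
have h2 : normc (pseries_val a ((rho (n k.+1))%:C * z) - (P k.+1).[(rho (n k.+1))%:C * z])
    <= 2 * 2^-1 ^+ k.+1.
  apply: limit_close; rewrite normcM normc_real z1 mulr1 ger0_norm //.
  by case/andP: (rho01 (n k.+1)).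
by rewrite /dilate; move: h2; rewrite exprS; lra.
Qed.

Lemma limit_universal : UA rho a.
Proof.
split; first exact: limit_holo.
move=> K KT KnT Kc phi fc.
have key (e : R) (N : nat) : 0 < e -> exists q, (N <= q)%N /\
    forall z, K z -> normc (dilate a (rho q) z - phi z) < e.
  (* Three errors of e/4: polynomial approximation, rational rounding, and the task error, for which
     2^-k <= e/8. *)
  move=> e0; have e4 : 0 < e / 4 by rewrite divr_gt0.
  have [p hp] := poly_dense Kc KT KnT fc e4.
  have [l hl] := rat_poly_dense p e4.
  have [x [j hK]] := proper_compact_arc Kc KT KnT.
  have h2 : 0 <= (2^-1 : R) < 1 by rewrite invr_ge0 ler0n invf_lt1 ?ltr1n.
  have e8 : 0 < e / 8 by rewrite divr_gt0.
  have [k0 hk] := expn_small h2 e8.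
  have [k kk tk] := task_at_often (x, j, l) (maxn N k0).
  exists (n k.+1); split.
    by have [h _] := index_ge k.+1; move: h kk; rewrite geq_max => h /andP[]; lia.
  move=> z Kz; have := @limit_dilate_approx k z; rewrite tk => /(_ (hK z Kz)) h3.
  have h4 := hp z Kz.
  have h5 : normc (p.[z] - (rat_poly R l).[z]) <= e / 4.
    apply: le_trans hl; rewrite -hornerN -hornerD; apply: normc_horner.
    by rewrite (KT z Kz).
  have h6 := hk k (leq_trans (leq_maxr N k0) kk).
  have h7 := normc_triangle (rat_poly R l).[z] (dilate a (rho (n k.+1)) z) (phi z).
  have h8 := normc_triangle p.[z] (rat_poly R l).[z] (phi z).
  rewrite /task_poly /= in h3; rewrite normc_distC in h5; lra.
have /choice[g hg] : forall x : nat * nat, exists q, (x.2 <= q)%N /\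
    forall z, K z -> normc (dilate a (rho q) z - phi z) < x.1.+1%:R^-1.
  by move=> [k N]; apply: key; rewrite invr_gt0.
(* Requiring an index at least one above the previous one makes the sequence strictly increasing. *)
pose nk := fix nk (k : nat) : nat := if k is k'.+1 then g (k, (nk k').+1) else g (0%N, 0%N).
have nkE k : forall z, K z -> normc (dilate a (rho (nk k)) z - phi z) < k.+1%:R^-1.
  by case: k => [|k]; [have [_] := hg (0%N, 0%N)|have [_] := hg (k.+1, (nk k).+1)].
exists nk; split.
  apply: homo_ltn; first exact: ltn_trans.
  by move=> k; have [] := hg (k.+1, (nk k).+1).
move=> e e0; have [N [hN _]] := exists_nat_ge e^-1.
exists N => // k /= Nk z Kz; apply: lt_le_trans (nkE k z Kz) _.
rewrite -[e]invrK lef_pV2 ?posrE ?invr_gt0 ?ltr0n // (le_trans hN) // ler_nat.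
exact: leq_trans Nk (leqnSn k).
Qed.

Lemma limit_partial_sums : {ae mu, forall t : R, I t ->
  (fun J => normc (partial_sum a J (expi t))) @ \oo --> +oo}.
Proof.
have mB k : measurable (B k) by have [_ _ _ []] := H k.
have mu0 : mu (lim_sup_set B) = 0%E.
  apply: lim_sup_set_cvg0 => //.
  apply: (@le_lt_trans _ _ (\sum_(0 <= k <oo) (2 / (2 ^ (k + 1))%:R)%:E)%E).
    apply: lee_nneseries => // k _.
    have [_ _ _ [_ h] _] := H k.
    rewrite (le_trans h) // lee_fin natrX addn1 exprS invfM mulrA divff ?mul1r //.
    by rewrite exprVn.
  have /cvg_lim e2 := @cvg_geometric_eseries_half R 2 0%N.
  by rewrite [X in (X < _)%E]e2 // ltry.
exists (lim_sup_set B); split=> //.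
  by apply: bigcap_measurable => // k _; apply: bigcup_measurable => j _; exact: mB.
move=> t /= nt; apply: contrapT => nB; apply: nt => It.
have [k0 hk0] : exists k0, forall k, (k0 <= k)%N -> ~ B k t.
  apply: contrapT => h; apply: nB => k0 _; apply: contrapT => h2; apply: h.
  by exists k0 => k kk Bk; apply: h2; exists k.
apply/cvgryPge => A.
have [k1 [hA _]] := exists_nat_ge A.
pose k := maxn k0 k1.
exists (m k.+1) => // J /= mJ.
(* Take the last [j] with [m j.+1 <= J]. Below [m j.+2] the limit has the coefficients of [P j.+1],
   so step [j] bounds this partial sum from below by [j]; the blocks leave no [J] out. *)
have [j [kj j1 j2]] : exists j, [/\ (k <= j)%N, (m j.+1 <= J)%N & (J < m j.+2)%N].
  have ex : exists j, (m j.+1 <= J)%N by exists k.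
  have bd j : (m j.+1 <= J)%N -> (j <= J)%N.
    by have [_] := index_ge j.+1; lia.
  have [j hj jmax] := ex_maxnP ex bd.
  exists j; split=> //; first exact: jmax.
  by rewrite ltnNge; apply/negP => /jmax; rewrite ltnn.
rewrite (partial_sumE (k := j.+1)) //.
have [_ _ _ _ h] := H j.
apply: le_trans (h t It (hk0 j _) J j1).
  by rewrite (le_trans hA) // ler_nat (leq_trans _ kj) // leq_maxr.
exact: leq_trans (leq_maxl _ _) kj.
Qed.

End Limit.
End Construction.

Theorem theorem4p10 (R : realType) (rho : nat -> R) :
  (forall n, 0 <= rho n < 1) ->
  {homo rho : i j / (i < j)%N >-> i < j} ->
  rho @ \oo --> (1 : R) ->
  exists a : nat -> R[i], UA rho a /\
    {ae (@lebesgue_measure R), forall t : R, `[0, 2 * pi[%classic t ->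
       (fun n => normc (partial_sum a n (expi t))) @ \oo --> +oo}.
Proof.
move=> rho01 rho_incr rho1.
have [P [n [m [B H]]]] := construction rho01 rho1.
exists (limit_coef P); split; first exact: (limit_universal rho01 rho_incr rho1 H).
exact: (limit_partial_sums H).
Qed.
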